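(* Let $G$ be a finite abelian group of order $n$, let $S$ be the set of bijections $\{1,\dots,n\}\to G$ (viewed as elements of $G^n$ with pointwise addition), let $d\ge 4$ be an integer, and let $f:\{1,\dots,n\}\to G$ be a function satisfying $\sum_{i=1}^n f(i)=d\sum_{x\in G}x$. Then the number of tuples $(\pi_1,\dots,\pi_d)\in S^d$ with $\pi_1+\cdots+\pi_d=f$ is \[ \big(1+O_d(n^{3-d})\big)\,\frac{n!^d}{n^{n-1}}, \] where the implied constant depends only on $d$.
   Context: Functions $\{1,\dots,n\}\to G$ are added pointwise. *)

(* Defs.v *)
From HB Require Import structures.
From mathcomp Require Import all_boot all_order all_algebra.
Set Implicit Arguments. Unset Strict Implicit. Unset Printing Implicit Defensive.
Import Order.TTheory GRing.Theory Num.Theory.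
Local Open Scope ring_scope.

(* Number of tuples (pi_1,...,pi_d) of bijections 'I_#|G| -> G with
   pi_1 + ... + pi_d = f (pointwise). Since #|'I_#|G|| = #|G|, injective
   functions are exactly bijections. *)
Definition num_solutions (G : finZmodType) (d : nat) (f : {ffun 'I_#|G| -> G}) : nat :=
  #|[set p : {ffun 'I_d -> {ffun 'I_#|G| -> G}} |
      [forall k, injectiveb (p k)] && (\sum_(k < d) p k == f)]|.

(* Main.v *)
Require Import Defs.
From HB Require Import structures.
From mathcomp Require Import all_boot all_order all_algebra.
From mathcomp Require Import all_fingroup all_solvable all_field all_character.
From mathcomp Require Import zify ring lra.
Set Implicit Arguments. Unset Strict Implicit. Unset Printing Implicit Defensive.
Import Order.TTheory GRing.Theory Num.Theory.
Local Open Scope ring_scope.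

(* Write n = #|G| and, for characters c_1, ..., c_n of G, let P(c) be the sum over the
   bijections pi of prod_i c_i(pi i).  By Fourier inversion on G^n the number of solutions
   is n^(-n) sum_c phase(c) P(c)^d.  The n constant tuples c contribute exactly n * n!^d,
   thanks to the hypothesis on f, so it suffices to show |P(c)| <= 5 n!/n for nonconstant c
   and sum_(c nonconstant) |P(c)|^4 = O(n!^4).

   Both rest on one estimate.  If the character x occurs a_x times in c, then P(c) is, up to
   the order of the stabiliser of c in S_n (at most prod a_x!), the coefficient of z^a in
   prod_g sum_x x(g) z_x.  AM-GM and the orthogonality of characters bound that polynomial
   by 1 on the torus |z_x|^2 = a_x/n, whence |P(c)|^2 <= (prod a_x!)^2 n^n / prod a_x^(a_x).

   The fourth moment is thereby reduced to a sum over compositions a of n of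
   prod a_x!^3 / a_x^(2 a_x), dominated by compositions with one very large part; it is
   bounded by generating functions with a well-chosen radius.  A last factor n is saved by
   the fact that P(c) = 0 unless the product of the c_i is trivial. *)

(** * Factorial ratios *)

(* Here 0 ^ 0 = 1, so that both ratios are 1 at a = 0. *)
HB.lock Definition fac2 (F : fieldType) (a : nat) : F :=
  (a`!)%:R ^+ 2 / a%:R ^+ a.
HB.lock Definition fac3 (F : fieldType) (a : nat) : F :=
  (a`!)%:R ^+ 3 / (a%:R ^+ a) ^+ 2.
(** Increases to e and governs consecutive ratios: [fac2] grows by (a+1)/e_a and [fac3] by
    (a+1)/e_a^2. Since 0^-1 = 0, the value at 0 is 1. *)
HB.lock Definition euler_seq (F : fieldType) (j : nat) : F := (1 + j%:R^-1) ^+ j.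

Section FactorialRatios.
Variable F : realFieldType.
Local Notation fac2 := (@fac2 F).
Local Notation fac3 := (@fac3 F).
Local Notation euler_seq := (@euler_seq F).

Lemma fac2E a : fac2 a = (a`!)%:R ^+ 2 / a%:R ^+ a.
Proof. by rewrite fac2.unlock. Qed.
Lemma fac3E a : fac3 a = (a`!)%:R ^+ 3 / (a%:R ^+ a) ^+ 2.
Proof. by rewrite fac3.unlock. Qed.
Lemma euler_seqE j : euler_seq j = (1 + j%:R^-1) ^+ j.
Proof. by rewrite euler_seq.unlock. Qed.

Lemma bernoulli (x : F) n : -1 <= x -> 1 + n%:R * x <= (1 + x) ^+ n.
Proof.
move=> hx; elim: n => [|n IH]; first by rewrite mul0r addr0.
rewrite exprS -natr1.
have h : 0 <= (1 + x) * ((1 + x) ^+ n - (1 + n%:R * x)).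
  by apply: mulr_ge0; [lra | rewrite subr_ge0].
have h2 : 0 <= n%:R * x ^+ 2 by apply: mulr_ge0; rewrite ?ler0n ?sqr_ge0.
nra.
Qed.

Lemma euler_seq_gt0 j : 0 < euler_seq j.
Proof.
by rewrite euler_seqE; apply: exprn_gt0; apply: ltr_pwDl => //; rewrite invr_ge0 ler0n.
Qed.

Lemma euler_seq_ge1 j : 1 <= euler_seq j.
Proof. by rewrite euler_seqE; apply: exprn_ege1; rewrite lerDl invr_ge0 ler0n. Qed.

Lemma exprSn_euler j : (j.+1)%:R ^+ j = euler_seq j * j%:R ^+ j :> F.
Proof.
case: j => [|j]; first by rewrite euler_seqE !expr0 mulr1.
rewrite euler_seqE -exprMn; congr (_ ^+ _).
by rewrite mulrDl mul1r mulVf ?pnatr_eq0 // natr1 .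
Qed.

(** e_(k+1) / e_k = (1 + 1/k) (1 - 1/(k+1)^2)^(k+1), and Bernoulli bounds this below by (1 + 1/k) (1
    - 1/(k+1)) = 1. *)
Lemma euler_seq_step j : euler_seq j <= euler_seq j.+1.
Proof.
case: j => [|j]; first by rewrite [euler_seq 0]euler_seqE expr0 euler_seq_ge1.
set k := j.+1.
have k0 : 0 < k%:R :> F by rewrite ltr0n.
have K0 : 0 < (k.+1)%:R :> F by rewrite ltr0n.
have hB := @bernoulli (- (k.+1)%:R ^- 2) k.+1.
have hi : (k.+1)%:R ^- 2 <= 1 :> F.
  by rewrite invf_le1 ?exprn_gt0 // exprn_ege1 // ler1n.
have {}hB : 1 + (k.+1)%:R * - (k.+1)%:R ^- 2 <= (1 - (k.+1)%:R ^- 2) ^+ k.+1 :> F.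
  by apply: hB; rewrite lerN2.
have -> : euler_seq k.+1
    = euler_seq k * ((1 + k%:R^-1) * (1 - (k.+1)%:R ^- 2) ^+ k.+1).
  rewrite !euler_seqE mulrA -exprSr -exprMn; congr (_ ^+ _).
  rewrite -natr1; rewrite -natr1 in K0; field; lra.
rewrite ler_pMr ?euler_seq_gt0 //.
apply: le_trans (_ : (1 + k%:R^-1) * (1 + (k.+1)%:R * - (k.+1)%:R ^- 2) <= _).
  have -> : (1 + k%:R^-1) * (1 + (k.+1)%:R * - (k.+1)%:R ^- 2) = 1 :> F.
    rewrite -natr1; rewrite -natr1 in K0; field; lra.
  by [].
by rewrite ler_pM2l // ltr_pwDl // invr_ge0 ltW.
Qed.

Lemma euler_seq_homo : {homo euler_seq : i j / (i <= j)%N >-> i <= j}.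
Proof. by apply: homo_leq => // [y x z | j]; [exact: le_trans | exact: euler_seq_step]. Qed.

(** The companion sequence (1 + 1/j)^(j+1) decreases, so each of its values bounds every e_j from
    above. *)
Lemma euler_upper_step j : (0 < j)%N ->
  euler_seq j.+1 * (1 + (j.+1)%:R^-1) <= euler_seq j * (1 + j%:R^-1).
Proof.
case: j => [//|j _]; set k := j.+1.
have k0 : 0 < k%:R :> F by rewrite ltr0n.
have k1 : 1 <= k%:R :> F by rewrite ler1n.
have K0 : 0 < (k.+1)%:R :> F by rewrite ltr0n.
pose x : F := (k%:R * (k%:R + 2))^-1.
have x0 : 0 <= x by rewrite invr_ge0 mulr_ge0 ?addr_ge0 // ltW.
have hB := @bernoulli x k.+1 ltac:(lra).
have E1 : (1 + k%:R^-1) = (1 + (k.+1)%:R^-1) * (1 + x).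
  rewrite /x -natr1; field; lra.
have -> : euler_seq k * (1 + k%:R^-1)
   = euler_seq k.+1 * (1 + x) ^+ k.+1.
  by rewrite !euler_seqE -exprSr {1}E1 exprMn.
rewrite ler_pM2l ?euler_seq_gt0 //; apply: le_trans hB.
rewrite lerD2l /x -natr1 ler_pdivlMr ?mulr_gt0 //; last by lra.
rewrite mulrC ler_pdivrMr; last by lra.
nra.
Qed.

Lemma euler_seq_sqr_le8 j : euler_seq j ^+ 2 <= 8.
Proof.
(* 13 is the least index at which (1 + 1/j)^(j+1) drops below the square root of 8; note 2.828^2 <
   8. *)
have h k : euler_seq (13 + k) * (1 + ((13 + k)%N%:R)^-1) <= euler_seq 13 * (1 + 13^-1).
  elim: k => [|k IH]; first by rewrite addn0.
  by apply: le_trans IH; rewrite addnS; apply: euler_upper_step.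
have h13 : euler_seq 13 * (1 + 13^-1) <= 2828 / 1000.
  rewrite euler_seqE -exprSr; rewrite !exprS expr0; lra.
have : euler_seq j <= 2828 / 1000.
  apply: le_trans (_ : euler_seq (13 + j) <= _).
    by apply: euler_seq_homo; rewrite leq_addl.
  apply: le_trans h13; apply: le_trans (h j).
  by rewrite ler_pMr ?euler_seq_gt0 // lerDl invr_ge0 ler0n.
have := euler_seq_gt0 j; nra.
Qed.

(** What matters is 6.19 > 6: the constant 6 in the bounds on [fac3] and the ratio 600/619 < 1 come
    from here. *)
Lemma euler_seq_sqr_ge j : (5 <= j)%N -> 619 / 100 <= euler_seq j ^+ 2.
Proof.
move=> hj; apply: le_trans (_ : euler_seq 5 ^+ 2 <= _).
  by rewrite euler_seqE -exprM !exprS expr0; lra.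
by rewrite ler_sqr ?nnegrE ?(ltW (euler_seq_gt0 _)) // euler_seq_homo.
Qed.

Lemma fac2S a : fac2 a.+1 = fac2 a * ((a.+1)%:R / euler_seq a).
Proof.
rewrite !fac2E factS natrM exprMn [(a.+1)%:R ^+ a.+1]exprS exprSn_euler.
have ha : (a.+1)%:R != 0 :> F by rewrite pnatr_eq0.
have he : euler_seq a != 0 by rewrite gt_eqF // euler_seq_gt0.
have hp : a%:R ^+ a != 0 :> F by rewrite expf_eq0 pnatr_eq0; lia.
move: (_%:R) ha (euler_seq a) he (a%:R ^+ a) hp => u hu v hv w hw.
by field; rewrite ?hu ?hv ?hw.
Qed.

Lemma fac3S a : fac3 a.+1 = fac3 a * ((a.+1)%:R / euler_seq a ^+ 2).
Proof.
rewrite !fac3E factS natrM exprMn [(a.+1)%:R ^+ a.+1]exprS exprSn_euler.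
have ha : (a.+1)%:R != 0 :> F by rewrite pnatr_eq0.
have he : euler_seq a != 0 by rewrite gt_eqF // euler_seq_gt0.
have hp : a%:R ^+ a != 0 :> F by rewrite expf_eq0 pnatr_eq0; lia.
move: (_%:R) ha (euler_seq a) he (a%:R ^+ a) hp => u hu v hv w hw.
by field; rewrite ?hu ?hv ?hw.
Qed.

Lemma fac2_0 : fac2 0 = 1.
Proof. by rewrite fac2E fact0 expr1n divr1. Qed.
Lemma fac3_0 : fac3 0 = 1.
Proof. by rewrite fac3E fact0 !expr1n divr1. Qed.
Lemma fac3_1 : fac3 1 = 1.
Proof. by rewrite fac3E (_ : 1`! = 1)%N // !expr1n divr1. Qed.

Lemma pow_self_gt0 a : 0 < a%:R ^+ a :> F.
Proof. by case: a => [|a]; [exact: ltr01 | rewrite exprn_gt0]. Qed.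

Lemma fac2_gt0 a : 0 < fac2 a.
Proof.
rewrite fac2E; apply: divr_gt0; last exact: pow_self_gt0.
by apply: exprn_gt0; rewrite ltr0n fact_gt0.
Qed.
Lemma fac3_gt0 a : 0 < fac3 a.
Proof.
rewrite fac3E; apply: divr_gt0; last exact: exprn_gt0 (pow_self_gt0 a).
by apply: exprn_gt0; rewrite ltr0n fact_gt0.
Qed.

(** Log-convexity of [fac2]: moving mass towards the larger part increases a product of two
    values. *)
Lemma fac2_ratio_homo :
  {homo (fun a => (a.+1)%:R / euler_seq a) : i j / (i <= j)%N >-> i <= j}.
Proof.
apply: homo_leq => // [y x z | j]; first exact: le_trans.
rewrite ler_pdivlMr ?euler_seq_gt0 // mulrAC ler_pdivrMr ?euler_seq_gt0 //.
have h : euler_seq j.+1 <= euler_seq j * (1 + (j.+1)%:R^-1).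
  rewrite !euler_seqE exprSr ler_pM2r; last by rewrite ltr_pwDl // invr_ge0 ler0n.
  case: j => [|j]; first by rewrite !expr0.
  rewrite lerXn2r // ?nnegrE ?addr_ge0 ?invr_ge0 ?ler0n // lerD2l.
  by rewrite lef_pV2 ?posrE ?ltr0n // ler_nat.
rewrite mulrC; apply: le_trans (ler_wpM2r (ler0n _ _) h) _.
rewrite -mulrA [_ * euler_seq j]mulrC ler_pM2l ?euler_seq_gt0 //.
by rewrite mulrDl mul1r mulVf ?pnatr_eq0 // natr1.
Qed.

Lemma fac2_1 : fac2 1 = 1.
Proof. by rewrite fac2E (_ : 1`! = 1)%N // !expr1n divr1. Qed.
Lemma fac2_2 : fac2 2 = 1.
Proof. by rewrite fac2E (_ : 2`! = 2)%N // divff // expf_eq0 pnatr_eq0. Qed.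

Lemma fac2_merge a b : fac2 a * fac2 b <= fac2 (a + b).
Proof.
elim: b => [|b IH]; first by rewrite fac2_0 mulr1 addn0.
rewrite addnS !fac2S mulrA; apply: ler_pM => //.
- by rewrite mulr_ge0 // ltW // fac2_gt0.
- by rewrite divr_ge0 ?ler0n // ltW // euler_seq_gt0.
by apply: fac2_ratio_homo; rewrite leq_addl.
Qed.

(** The induction starts at b = 2, where [fac2] is still 1; this saves two units of mass over
    [fac2_merge]. *)
Lemma fac2_merge2 a b : (2 <= a)%N -> (2 <= b)%N -> fac2 a * fac2 b <= fac2 (a + b - 2).
Proof.
move=> ha; elim: b => [//|b IH]; rewrite ltnS leq_eqVlt => /predU1P[<-|hb].
  by rewrite fac2_2 mulr1 addnK.
rewrite (_ : (a + b.+1 - 2 = (a + b - 2).+1)%N); last by lia.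
rewrite [fac2 b.+1]fac2S [fac2 (_ - _).+1]fac2S mulrA; apply: ler_pM.
- by rewrite mulr_ge0 // ltW // fac2_gt0.
- by rewrite divr_ge0 ?ler0n // ltW // euler_seq_gt0.
- exact: IH.
by apply: fac2_ratio_homo; lia.
Qed.

Lemma euler_seq_le3 j : euler_seq j <= 3.
Proof. have := euler_seq_sqr_le8 j; have := euler_seq_gt0 j; nra. Qed.

Lemma fac2_ge1 a : 1 <= fac2 a.
Proof.
elim: a => [|a IH]; first by rewrite fac2_0.
rewrite fac2S; apply: mulr_ege1 => //.
apply: le_trans (fac2_ratio_homo (leq0n a)).
by rewrite euler_seqE expr0 divr1.
Qed.

(* The lost factor n^2 is two steps of the ratio (a+1)/e_a >= (a+1)/3. *)
Lemma fac2_sub2 n : (2 <= n)%N -> n%:R ^+ 2 * fac2 (n - 2) <= 18 * fac2 n.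
Proof.
case: n => [|[|n]] // _; rewrite subSS subSS subn0 !fac2S.
have g0 := fac2_gt0 n.
have h (j : nat) : 3^-1 <= (euler_seq j)^-1.
  by rewrite lef_pV2 ?posrE ?euler_seq_gt0 // euler_seq_le3.
set u := (n.+1)%:R; set v := (n.+2)%:R.
have hu : 0 < u :> F by rewrite ltr0n.
have hv : v = u + 1 by rewrite /v /u natr1.
have u1 : 1 <= u :> F by rewrite ler1n.
have h1 : u / 3 <= u / euler_seq n by rewrite ler_pM2l.
have h2 : v / 3 <= v / euler_seq n.+1 by rewrite ler_pM2l ?hv //; lra.
have h3 : (u / 3) * (v / 3) <= (u / euler_seq n) * (v / euler_seq n.+1).
  by apply: ler_pM => //; apply: divr_ge0; lra.
rewrite -[fac2 n * _ * _]mulrA [fac2 n * _]mulrC [18 * _]mulrA ler_pM2r //.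
apply: le_trans (_ : 18 * (u / 3 * (v / 3)) <= _); last by rewrite ler_pM2l.
rewrite hv; nra.
Qed.

End FactorialRatios.

(** * Growth, decay and generating series of [fac3] *)

Section FactorialEstimates.
Variable F : realFieldType.
Local Notation fac2 := (@fac2 F).
Local Notation fac3 := (@fac3 F).
Local Notation euler_seq := (@euler_seq F).

Let fac3_ge0 a : 0 <= fac3 a. Proof. exact/ltW/fac3_gt0. Qed.
Local Hint Resolve fac3_ge0 : core.

Lemma pow_self_le a : a%:R ^+ a <= 3 ^+ a * (a`!)%:R :> F.
Proof.
elim: a => [|a IH]; first by rewrite mul1r.
rewrite exprS exprSn_euler factS natrM.
have h : euler_seq a * a%:R ^+ a <= 3 * (3 ^+ a * (a`!)%:R).
  apply: ler_pM => //; last exact: euler_seq_le3; apply: ltW.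
    exact: euler_seq_gt0.
  exact: pow_self_gt0.
rewrite exprS [leRHS]mulrCA -[3 * _ * _]mulrA; apply: ler_wpM2l; by [].
Qed.

Lemma fac3_ge N : N%:R ^+ N / 27 ^+ N <= fac3 N.
Proof.
have h := pow_self_le N; have h0 := pow_self_gt0 F N.
rewrite ler_pdivrMr ?exprn_gt0 // fac3E mulrAC ler_pdivlMr; last exact: exprn_gt0.
have -> : (27 : F) ^+ N = (3 ^+ N) ^+ 3 by rewrite exprAC; congr (_ ^+ _); rewrite -natrX.
by rewrite -exprS mulrC -exprMn lerXn2r // nnegrE ?(ltW h0) // mulr_ge0 ?exprn_ge0.
Qed.

Lemma fac3_ratio_le1 b : (b <= 4)%N -> (b.+1)%:R / euler_seq b ^+ 2 <= 1.
Proof.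
move=> hb; rewrite ler_pdivrMr ?mul1r; last exact/exprn_gt0/euler_seq_gt0.
have h1 : euler_seq 1 = 2 by rewrite euler_seqE expr1 invr1.
have h2 : euler_seq 2 = 9 / 4 by rewrite euler_seqE !exprS expr0; lra.
have e0 := euler_seq_gt0 F b.
case: b hb e0 => [|[|b]] hb e0.
- by rewrite exprn_ege1 ?euler_seq_ge1.
- by rewrite h1 -natrX ler_nat.
(* For the indices 2, 3 and 4 it suffices that 5 < (9/4)^2 = 81/16. *)
have h : 9 / 4 <= euler_seq b.+2 by rewrite -h2; apply: euler_seq_homo.
have hb5 : (b.+3)%:R <= 5 :> F by rewrite ler_nat.
nra.
Qed.

Lemma fac3_ratio_le b : (5 <= b)%N ->
  (b.+1)%:R / euler_seq b ^+ 2 <= (100 / 619) * (b.+1)%:R.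
Proof.
move=> /(euler_seq_sqr_ge F) h; rewrite mulrC ler_wpM2r // invf_ple ?posrE; first by lra.
- by rewrite exprn_gt0 // euler_seq_gt0.
lra.
Qed.

(** Each step of [fac3] on the way to b multiplies by at most t: by at most 1 up to index 5, and by
    at most b / 6.19 <= t beyond. *)
Lemma fac3_le_exp (t : F) b : 1 <= t -> b%:R <= 6 * t -> fac3 b <= t ^+ b.
Proof.
move=> t1; elim: b => [|b IH] hb; first by rewrite fac3_0.
rewrite fac3S [t ^+ _]exprSr; apply: ler_pM.
- exact/ltW/fac3_gt0.
- by rewrite divr_ge0 ?sqr_ge0.
- by apply: IH; apply: le_trans hb; rewrite ler_nat.
have [h|h] := leqP b 4; first exact: le_trans (fac3_ratio_le1 h) t1.
by apply: le_trans (fac3_ratio_le h) _; lra.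
Qed.

Lemma fac3_le1 b : (b <= 5)%N -> fac3 b <= 1.
Proof.
move=> hb; rewrite -[1](expr1n _ b); apply: fac3_le_exp => //.
by rewrite mulr1 ler_nat; apply: leq_trans hb _.
Qed.

(** Each step multiplies [fac3] by (a+1)/e_a^2 >= (a+1)/8; m steps collect a falling factorial. *)
Lemma fac3_ffact r m : fac3 r * ((r + m) ^_ m)%:R <= 8 ^+ m * fac3 (r + m).
Proof.
elim: m => [|m IH]; first by rewrite addn0 mul1r mulr1.
rewrite addnS ffactSS fac3S natrM exprS.
have e0 : 0 < euler_seq (r + m) ^+ 2 by rewrite exprn_gt0 // euler_seq_gt0.
have h8 := euler_seq_sqr_le8 F (r + m).
set u := (_.+1)%:R; have u0 : 0 <= u :> F by rewrite ler0n.
have -> : fac3 r * (u * ((r + m) ^_ m)%:R) = u * (fac3 r * ((r + m) ^_ m)%:R) by ring.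
apply: le_trans (ler_wpM2l u0 IH) _.
have -> : 8 * 8 ^+ m * (fac3 (r + m) * (u / euler_seq (r + m) ^+ 2))
  = u * (8 ^+ m * fac3 (r + m)) * (8 / euler_seq (r + m) ^+ 2) by ring.
rewrite ler_peMr //; last by rewrite ler_pdivlMr // mul1r.
by rewrite !mulr_ge0 ?exprn_ge0.
Qed.

(* Pair each factor of the falling factorial with its mirror image. *)
Lemma leq_ffact_sqr r m : ((r * (r + m)) ^ m <= ((r + m) ^_ m) ^ 2)%N.
Proof.
rewrite -mulnn ffact_prod {2}(reindex_inj rev_ord_inj) -big_split /=.
rewrite -[X in (_ ^ X <= _)%N]card_ord -prod_nat_const.
apply: leq_prod => i _; have := ltn_ord i; nia.
Qed.

(** After squaring, [fac3_ffact], [leq_ffact_sqr] and r(r+m) >= 2y^2 reduce the claim to (8/6)^2 <=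
    2 (17/18)^2, that is, 288 <= 289. *)
Lemma fac3_decay (y : F) r m : 0 <= y -> y <= r%:R -> 2 * y <= (r + m)%:R ->
  fac3 r * (y / 6) ^+ m <= (17 / 18) ^+ m * fac3 (r + m).
Proof.
move=> y0 yr yN; have g0 := fac3_gt0 F r; have G0 := fac3_gt0 F (r + m).
have h1 := fac3_ffact r m.
have h2 : (r%:R * (r + m)%:R) ^+ m <= ((r + m) ^_ m)%:R ^+ 2 :> F.
  by rewrite -natrM -!natrX ler_nat leq_ffact_sqr.
have p8 : 0 < 8 ^+ m :> F by rewrite exprn_gt0.
rewrite -(ler_pM2l p8) -ler_sqr ?nnegrE; first last.
- by rewrite !mulr_ge0 ?exprn_ge0 ?divr_ge0.
- by rewrite !mulr_ge0 ?exprn_ge0 ?divr_ge0.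
have -> : (8 ^+ m * ((17 / 18) ^+ m * fac3 (r + m))) ^+ 2
  = ((17 / 18) ^+ 2) ^+ m * (8 ^+ m * fac3 (r + m)) ^+ 2.
  by rewrite [((17 / 18) ^+ 2) ^+ m]exprAC; ring.
apply: le_trans (_ : ((17 / 18) ^+ 2) ^+ m * (fac3 r * ((r + m) ^_ m)%:R) ^+ 2 <= _); last first.
  rewrite ler_wpM2l ?exprn_ge0 ?divr_ge0 //.
  by rewrite lerXn2r // nnegrE mulr_ge0 ?exprn_ge0.
rewrite [(fac3 r * _%:R) ^+ 2]exprMn.
apply: le_trans (_ : ((17 / 18) ^+ 2) ^+ m * (fac3 r ^+ 2 * (r%:R * (r + m)%:R) ^+ m) <= _);
  last first.
  rewrite ler_wpM2l ?exprn_ge0 ?divr_ge0 //.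
  by rewrite ler_wpM2l // sqr_ge0.
have -> : (8 ^+ m * (fac3 r * (y / 6) ^+ m)) ^+ 2
   = fac3 r ^+ 2 * ((8 * (y / 6)) ^+ 2) ^+ m.
  by rewrite [((8 * (y / 6)) ^+ 2) ^+ m]exprAC [(8 * (y / 6)) ^+ m]exprMn; ring.
rewrite [leRHS]mulrCA ler_wpM2l ?sqr_ge0 // -exprMn.
apply: lerXn2r; rewrite ?nnegrE ?sqr_ge0 //.
  by apply: mulr_ge0; [exact: sqr_ge0 | exact: mulr_ge0].
have : y * (2 * y) <= r%:R * (r + m)%:R by apply: ler_pM => //; lra.
nra.
Qed.

(** Up to b = 5, where the truncated b - 5 vanishes, [fac3] is at most 1; each later step costs a
    factor at most 6/6.19 = 600/619. *)
Lemma fac3_term_le (z : F) b : 0 <= z -> z <= 1 -> z * b%:R <= 6 -> (2 <= b)%N ->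
  fac3 b * z ^+ b <= z ^+ 2 * (600 / 619) ^+ (b - 5).
Proof.
move=> z0 z1; elim: b => [//|b IH] hz; rewrite ltnS => hb.
have [h|h] := leqP b 4.
  rewrite (_ : (b.+1 - 5 = 0)%N) ?expr0 ?mulr1; last by lia.
  rewrite -[leRHS]mul1r; apply: ler_pM; rewrite ?exprn_ge0 //.
    exact: fac3_le1.
  exact: ler_wiXn2l.
rewrite (_ : (b.+1 - 5 = (b - 5).+1)%N); last by lia.
have h1 : (2 <= b)%N by lia.
have h2 : z * b%:R <= 6 by apply: le_trans hz; rewrite ler_wpM2l // ler_nat.
have -> : fac3 b.+1 * z ^+ b.+1
   = (fac3 b * z ^+ b) * (z * ((b.+1)%:R / euler_seq b ^+ 2)).
  by rewrite fac3S [z ^+ b.+1]exprS; ring.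
rewrite [_ ^+ (b - 5).+1]exprSr [leRHS]mulrA; apply: ler_pM.
- by rewrite mulr_ge0 ?exprn_ge0.
- by rewrite mulr_ge0 // divr_ge0 ?sqr_ge0.
- exact: IH.
apply: le_trans (ler_wpM2l z0 (fac3_ratio_le h)) _; lra.
Qed.

Lemma geom_sum_le (q : F) n : 0 <= q -> q < 1 -> \sum_(i < n) q ^+ i <= (1 - q)^-1.
Proof.
move=> q0 q1; have h := subrX1 q n.
have hq : 0 <= q ^+ n by rewrite exprn_ge0.
rewrite -[leRHS]mul1r ler_pdivlMr; last by lra.
nra.
Qed.

Lemma sum_fac3_le (z : F) B : 0 <= z -> z <= 1 -> z * B%:R <= 6 ->
  \sum_(2 <= b < B.+1) fac3 b * z ^+ b <= 40 * z ^+ 2.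
Proof.
move=> z0 z1 hz; have [->|B0] := posnP B.
  by rewrite big_geq // mulr_ge0 ?sqr_ge0.
apply: le_trans (_ : \sum_(2 <= b < B.+1) z ^+ 2 * (600 / 619) ^+ (b - 5) <= _).
  rewrite big_nat_cond [leRHS]big_nat_cond; apply: ler_sum => b /andP[/andP[h1 h2] _].
  apply: fac3_term_le => //; apply: le_trans hz.
  by rewrite ler_wpM2l // ler_nat.
rewrite -big_distrr /= mulrC ler_wpM2r ?sqr_ge0 //.
have h0 : forall i : nat, 0 <= (600 / 619) ^+ i :> F by move=> i; rewrite exprn_ge0 // divr_ge0.
apply: le_trans (_ : \sum_(2 <= b < 5 + B) (600 / 619) ^+ (b - 5) <= _).
  rewrite (@big_cat_nat _ _ _ B.+1 2 (5 + B)%N) /=; last by lia.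
    by rewrite lerDl sumr_ge0.
  lia.
(* The terms 2, 3, 4 contribute 1 each and the geometric tail at most 619/19 < 33, altogether less
   than 40. *)
rewrite (@big_cat_nat _ _ _ 5) //=.
rewrite big_ltn // big_ltn // big_ltn // big_geq // !expr0.
rewrite -{1}[5%N]add0n big_addn addKn big_mkord.
have := @geom_sum_le (600 / 619) B ltac:(lra) ltac:(lra).
under [X in _ + X <= _]eq_bigr do rewrite addnK.
have -> : (1 - 600 / 619)^-1 = 619 / 19 :> F by field.
lra.
Qed.

End FactorialEstimates.

(** * Sums over compositions *)

Section CompositionSums.
Variable F : realFieldType.
Local Notation fac3 := (@fac3 F).

Lemma ler_sum_union (I J : finType) (C : pred I) (D : J -> pred I) (w : I -> F) :
  (forall i, 0 <= w i) -> (forall i, C i -> exists j, D j i) ->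
  \sum_(i | C i) w i <= \sum_j \sum_(i | D j i) w i.
Proof.
move=> w0 hC; under [leRHS]eq_bigr do rewrite big_mkcond.
rewrite exchange_big /= big_mkcond; apply: ler_sum => i _.
case: ifP => [/hC[j hj]|_]; last by apply: sumr_ge0 => j _; case: ifP.
by rewrite (bigD1 j) //= hj lerDl; apply: sumr_ge0 => j' _; case: ifP.
Qed.

Lemma sum_ord_lt_le n B (w : nat -> F) : (forall i, 0 <= w i) ->
  \sum_(j < n | (j < B)%N) w j <= \sum_(0 <= j < B) w j.
Proof.
move=> w0; rewrite -(big_mkord (fun j => (j < B)%N) w).
have -> : \sum_(0 <= j < B) w j = \sum_(0 <= j < n + B | (j < B)%N) w j.
  by rewrite (big_nat_widen _ _ (n + B)) ?leq_addl.
rewrite (big_nat_widen _ _ (n + B)) ?leq_addr //.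
rewrite [leLHS]big_mkcond [leRHS]big_mkcond; apply: ler_sum => j _ /=.
by case: ifP => [/andP[->]|] //; case: ifP.
Qed.

Section Compositions.
Variables (X : finType) (M N : nat) (phi : nat -> F).
Hypothesis phi_ge0 : forall b, 0 <= phi b.

Definition weight (a : {ffun X -> 'I_M.+1}) : F := \prod_x phi (a x).
Definition total (a : {ffun X -> 'I_M.+1}) : nat := (\sum_x a x)%N.

Lemma weight_ge0 a : 0 <= weight a.
Proof. exact: prodr_ge0. Qed.

Lemma weight_scale (z : F) a : weight a * z ^+ total a = \prod_x (phi (a x) * z ^+ a x).
Proof. by rewrite /total -prodrXr -big_split. Qed.

(** Rankin's trick: a coefficient of a series with nonnegative terms is at most the value of the
    series at z divided by z^N. *)
Lemma sum_weight_family (z : F) (Q : X -> pred 'I_M.+1) : 0 <= z ->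
  (\sum_(a in family Q | total a == N) weight a) * z ^+ N
    <= \prod_x \sum_(j | Q x j) phi j * z ^+ j.
Proof.
move=> z0; rewrite bigA_distr_big_dep big_distrl /=.
rewrite [leRHS](bigID (fun a => total a == N)) /=.
rewrite [X in _ <= X + _](eq_bigr (fun a => weight a * z ^+ N)); last first.
  by move=> a /andP[_ /eqP <-]; rewrite weight_scale.
rewrite lerDl; apply: sumr_ge0 => a _; apply: prodr_ge0 => x _.
by rewrite mulr_ge0 ?exprn_ge0.
Qed.

(** Rankin's trick again, but a term of the wrong degree is subtracted; this will remove the
    dominant contribution of a single part. *)
Lemma sum_weight_family_sub (z : F) (Q : X -> pred 'I_M.+1) a0 : 0 <= z ->
  a0 \in family Q -> total a0 != N ->
  (\sum_(a in family Q | total a == N) weight a) * z ^+ N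
    <= \prod_x (\sum_(j | Q x j) phi j * z ^+ j) - \prod_x (phi (a0 x) * z ^+ a0 x).
Proof.
move=> z0 a0Q a0N; rewrite bigA_distr_big_dep big_distrl /=.
rewrite lerBrDr [leRHS](bigID (fun a => total a == N)) /=.
rewrite [X in _ <= X + _](eq_bigr (fun a => weight a * z ^+ N)); last first.
  by move=> a /andP[_ /eqP <-]; rewrite weight_scale.
rewrite lerD2l (bigD1 a0) /= ?a0Q // lerDl; apply: sumr_ge0 => a _.
by apply: prodr_ge0 => x _; rewrite mulr_ge0 ?exprn_ge0.
Qed.

Section Core.
Hypothesis N_large : (192 <= N)%N.
Hypothesis X_small : (#|X| <= N.+1)%N.
Hypothesis phi0 : phi 0 = 1.
Hypothesis phi_le : forall b, phi b <= fac3 b.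

Let N0 : 0 < N%:R :> F. Proof. by rewrite ltr0n; lia. Qed.
Let N192 : 192 <= N%:R :> F. Proof. by rewrite ler_nat. Qed.

(* Each part is at most N/32, so phi j <= (N/192)^j: at the radius 96/N every factor of the
   generating function is at most 2. *)
Lemma sum_weight_small_parts :
  \sum_(a in family (fun=> [pred j : 'I_M.+1 | (32 * j <= N)%N]) | total a == N) weight a
    <= fac3 N.
Proof.
pose z : F := 96 / N%:R.
have z0 : 0 < z by rewrite divr_gt0.
have zN0 : 0 < z ^+ N by rewrite exprn_gt0.
rewrite -(ler_pM2r zN0); apply: le_trans (sum_weight_family _ (ltW z0)) _.
apply: le_trans (_ : 2 ^+ N.+1 <= _).
  apply: le_trans (_ : 2 ^+ #|X| <= _); last by rewrite ler_weXn2l ?ler1n.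
  rewrite -prodr_const; apply: ler_prod => x _; apply/andP; split.
    by apply: sumr_ge0 => j _; rewrite mulr_ge0 ?exprn_ge0 // ltW.
  apply: le_trans (_ : \sum_(j < M.+1) (1 / 2) ^+ j <= _); last first.
    have e2 : (1 - 1 / 2)^-1 = 2 :> F by field.
    by rewrite -[leRHS]e2; apply: geom_sum_le; lra.
  rewrite big_mkcond; apply: ler_sum => j _; case: ifP => /= hj; last by apply: exprn_ge0; lra.
  have ht : fac3 j <= (N%:R / 192) ^+ j.
    apply: fac3_le_exp; first by rewrite ler_pdivlMr // mul1r.
    have : (32 * j)%:R <= N%:R :> F by rewrite ler_nat.
    by rewrite natrM; lra.
  apply: le_trans (_ : (N%:R / 192) ^+ j * z ^+ j <= _).
    by rewrite ler_wpM2r ?exprn_ge0 // ?(ltW z0) // (le_trans (phi_le j)).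
  have e : N%:R / 192 * z = 1 / 2 by rewrite /z; field; rewrite gt_eqF.
  by rewrite -exprMn e.
apply: le_trans (ler_wpM2r (ltW zN0) (fac3_ge F N)).
rewrite /z expr_div_n.
have -> : N%:R ^+ N / 27 ^+ N * (96 ^+ N / N%:R ^+ N) = (96 / 27) ^+ N :> F.
  have h1 : N%:R ^+ N != 0 :> F by rewrite gt_eqF ?exprn_gt0.
  rewrite expr_div_n mulrC -mulrA; congr (_ * _).
  by rewrite mulrA mulVf // mul1r.
(* Two of the N factors absorb the extra 2 in 2^(N+1), since (96/27)^2 > 8. *)
have [k ->] : exists k, N = k.+2 by exists (N - 2)%N; lia.
rewrite !exprS; have h : 2 ^+ k <= (96 / 27) ^+ k :> F by rewrite lerXn2r // ?nnegrE; lra.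
have : 0 <= 2 ^+ k :> F by rewrite exprn_ge0.
lra.
Qed.

(** Bounds what the parts other than the largest contribute, the all-zero choice excluded. The base
    collects parts 0, 1 and >= 2 at a radius at most 192/N; [phi 1] stays explicit because a weight
    with [phi 1] = 0 has a much smaller gain. *)
Definition gain : F := (1 + phi 1 * (192 / N%:R) + 40 * (192 / N%:R) ^+ 2) ^+ #|X| - 1.

Definition max_part_at (x0 : X) (r : 'I_M.+1) (x : X) : pred 'I_M.+1 :=
  [pred j : 'I_M.+1 | if x == x0 then j == r else (j <= r)%N && (j <= N - r)%N].

(* The radius is z = 6/y with y = min(r, N/2).  All other parts are at most y, so
   sum_fac3_le applies, while fac3_decay shows that z^(r-N) fac3 r is still
   exponentially smaller than fac3 N. *)
Lemma sum_weight_max_part x0 (r : 'I_M.+1) : (N <= 32 * r)%N -> (r < N)%N ->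
  \sum_(a in family (max_part_at x0 r) | total a == N) weight a
  <= (17 / 18) ^+ (N - r) * fac3 N * gain.
Proof.
move=> Nr rN; set Q := max_part_at x0 r.
pose y : F := if (2 * r <= N)%N then r%:R else N%:R / 2.
have hNr : N%:R <= 32 * r%:R :> F by rewrite -natrM ler_nat.
have [yr yN Ny By] : [/\ y <= r%:R, 2 * y <= N%:R, N%:R <= 32 * y &
    forall j : nat, (j <= r)%N -> (j <= N - r)%N -> j%:R <= y].
  rewrite /y; case: (leqP (2 * r) N) => /= h.
    have h' : 2 * r%:R <= N%:R :> F by rewrite -natrM ler_nat.
    by split=> // j h1 _; rewrite ler_nat.
  have h' : N%:R <= 2 * r%:R :> F by rewrite -natrM ler_nat ltnW.
  split=> [|||j h1 h2]; [lra|lra| |].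
    by have := N192; lra.
  have : 2 * j%:R <= N%:R :> F by rewrite -natrM ler_nat; lia.
  lra.
have hN0 := N0; have hN192 := N192.
have y0 : 0 < y by lra.
pose z := 6 / y; pose z1 : F := 192 / N%:R.
have z0 : 0 < z by rewrite divr_gt0.
have zz1 : z <= z1 by rewrite /z /z1 ler_pdivrMr // mulrAC ler_pdivlMr //; lra.
have z11 : z1 <= 1 by rewrite /z1 ler_pdivrMr // mul1r.
have p1 : 0 <= phi 1 by [].
set c := 1 + phi 1 * z1 + 40 * z1 ^+ 2.
have c1 : 1 <= c.
  have := sqr_ge0 z1; have : 0 <= phi 1 * z1 by rewrite mulr_ge0 //; lra.
  rewrite /c; lra.
(* The part r at [x0] alone has total r < N. Subtracting its term turns c^|X| into c^|X| - 1, which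
   is the gain. *)
pose a0 : {ffun X -> 'I_M.+1} := [ffun x => if x == x0 then r else ord0].
have a0Q : a0 \in family Q.
  by apply/familyP => x; rewrite /Q /max_part_at ffunE inE; case: (x == x0) => //=.
have ta0 : total a0 = r.
  rewrite /total (bigD1 x0) //= ffunE eqxx big1 ?addn0 // => x /negPf h.
  by rewrite ffunE h.
have ta0N : total a0 != N by rewrite ta0 neq_ltn rN.
have := sum_weight_family_sub (ltW z0) a0Q ta0N.
rewrite -(weight_scale z a0) ta0.
have -> : weight a0 = phi r.
  rewrite /weight (bigD1 x0) //= ffunE eqxx big1 ?mulr1 // => x /negPf h.
  by rewrite ffunE h.
rewrite (bigD1 x0) //= (big_pred1 r); last by move=> j; rewrite /Q /max_part_at inE eqxx.
set S := \sum_(a in _ | _) _.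
set P := \prod_(x | _) _.
have hP : P <= c ^+ #|X|.
  apply: le_trans (_ : \prod_(x | x != x0) c <= _); last first.
    by rewrite prodr_const ler_weXn2l // max_card.
  apply: ler_prod => x /negPf hx; rewrite /Q /max_part_at hx; apply/andP; split.
    by apply: sumr_ge0 => j _; rewrite mulr_ge0 ?exprn_ge0 // ltW.
  pose B := minn r (N - r).
  apply: le_trans (_ : \sum_(0 <= j < B.+1) phi j * z ^+ j <= _).
    apply: le_trans (@sum_ord_lt_le M.+1 _ (fun j => phi j * z ^+ j) _) => [|j].
      by rewrite le_eqVlt; apply/orP; left; apply/eqP/eq_bigl => j; rewrite inE /B ltnS leq_min.
    by rewrite mulr_ge0 ?exprn_ge0 // ltW.
  have zB : z * B%:R <= 6.
    rewrite /z mulrAC ler_pdivrMr // ler_pM2l //; by apply: By; rewrite /B ?geq_minl ?geq_minr.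
  have r0 : (0 < r)%N by rewrite -(ltr0n F); lra.
  have B0 : (0 < B)%N by rewrite /B leq_min r0 subn_gt0.
  rewrite big_ltn // big_ltn // phi0 expr0 mulr1 expr1 /c addrA; apply: lerD.
    by rewrite lerD2l ler_wpM2l.
  apply: le_trans (_ : \sum_(2 <= j < B.+1) fac3 j * z ^+ j <= _).
    by apply: ler_sum => j _; rewrite ler_wpM2r ?exprn_ge0 // ltW.
  apply: le_trans (sum_fac3_le (ltW z0) _ zB) _; first by lra.
  by rewrite ler_pM2l // lerXn2r // nnegrE; lra.
move=> hS.
have zN0 : 0 < z ^+ N by rewrite exprn_gt0.
rewrite -(ler_pM2r zN0); apply: le_trans hS _.
have G0 : 0 <= gain by rewrite /gain subr_ge0 exprn_ege1.
apply: le_trans (_ : phi r * z ^+ r * gain <= _).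
  rewrite -{2}[phi r * z ^+ r]mulr1 -mulrBr ler_wpM2l ?mulr_ge0 ?exprn_ge0 // ?(ltW z0) //.
  by rewrite lerD2r.
rewrite [leRHS]mulrAC; apply: ler_wpM2r => //.
have hd := @fac3_decay F y r (N - r) (ltW y0) yr.
rewrite subnKC in hd; last exact: ltnW.
have {}hd := hd yN.
have e : z ^+ N = z ^+ (N - r) * z ^+ r by rewrite -exprD subnK // ltnW.
rewrite e mulrA; apply: ler_wpM2r; first by rewrite exprn_ge0 // ltW.
have zr0 : 0 < z ^+ (N - r) by rewrite exprn_gt0.
rewrite -ler_pdivrMr //; apply: le_trans hd.
rewrite -exprVn /z invf_div; apply: ler_wpM2r => //.
by rewrite exprn_ge0 // divr_ge0 // ltW.
Qed.

(** Either all parts are at most N/32, or a largest part r sits at one of |X| places and the decay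
    (17/18)^(N-r) sums over r < N to at most 18. *)
Lemma sum_weight_nonconst :
  \sum_(a | (total a == N) && [forall x, (a x < N)%N]) weight a
    <= fac3 N * (1 + 18 * (#|X|%:R * gain)).
Proof.
have f0 := fac3_gt0 F N.
have G0 : 0 <= gain.
  rewrite /gain subr_ge0 exprn_ege1 // -addrA lerDl; apply: addr_ge0.
    by apply: mulr_ge0 => //; apply: divr_ge0.
  by apply: mulr_ge0; rewrite ?sqr_ge0.
rewrite (bigID (fun a : {ffun X -> 'I_M.+1} => [forall x, (32 * a x <= N)%N])) /=.
rewrite mulrDr mulr1; apply: lerD.
  apply: le_trans sum_weight_small_parts.
  rewrite [leLHS]big_mkcond [leRHS]big_mkcond; apply: ler_sum => a _.
  case: ifP => [/andP[/andP[-> _] /forallP h]|_]; last by case: ifP => // _; exact: weight_ge0.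
  by rewrite andbT ifT //; apply/familyP => x; rewrite inE.
pose D (p : X * 'I_M.+1) (a : {ffun X -> 'I_M.+1}) :=
  [&& (N <= 32 * p.2)%N, (p.2 < N)%N,
   a \in family (max_part_at p.1 p.2) & total a == N].
apply: le_trans (@ler_sum_union _ _ _ D _ weight_ge0 _) _.
  move=> a /andP[/andP[/eqP ta /forallP aN] /forallPn[x1 hx1]].
  have [x0 _ hmax] := @arg_maxnP X x1 xpredT (fun x => a x) isT.
  exists (x0, a x0); rewrite /D /= aN ta eqxx andbT.
  have h1 : (a x1 <= a x0)%N by apply: hmax.
  apply/andP; split.
    by rewrite -ltnNge in hx1; apply: leq_trans (ltnW hx1) _; rewrite leq_mul2l h1.
  apply/familyP => x; rewrite /max_part_at inE; case: eqP => [->|/eqP hx]; first by rewrite eqxx.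
  apply/andP; split; first exact: hmax.
  by rewrite -ta /total (bigD1 x0) //= addKn (bigD1 x) //= leq_addr.
rewrite -(pair_big xpredT xpredT (fun x r => \sum_(a | D (x, r) a) weight a)) /=.
apply: le_trans (_ : \sum_(x0 : X) fac3 N * (18 * gain) <= _); last first.
  by rewrite sumr_const -mulr_natr le_eqVlt; apply/orP; left; apply/eqP; ring.
apply: ler_sum => x0 _.
apply: le_trans (_ : \sum_(r < M.+1 | (r < N)%N) (17 / 18) ^+ (N - r) * (fac3 N * gain) <= _).
  rewrite [leRHS]big_mkcond; apply: ler_sum => r _.
  rewrite /D /=; case: (leqP N (32 * r)) => Nr; last first.
    rewrite big_pred0_eq; case: ifP => // _; rewrite !mulr_ge0 ?exprn_ge0 // ?(ltW f0) //; lra.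
  case: ltnP => rN; last by rewrite big_pred0_eq.
  by rewrite mulrA; apply: le_trans (sum_weight_max_part x0 Nr rN).
apply: le_trans (@sum_ord_lt_le M.+1 N (fun r => (17 / 18) ^+ (N - r) * (fac3 N * gain)) _) _.
  by move=> r; rewrite !mulr_ge0 ?exprn_ge0 // ?(ltW f0) //; lra.
rewrite -big_distrl /= [leRHS]mulrCA; apply: ler_wpM2r.
  by apply: mulr_ge0 => //; apply: ltW.
rewrite big_mkord (reindex_inj rev_ord_inj) /=.
under eq_bigr => i _ do rewrite subKn // exprS.
rewrite -big_distrr /=.
have e18 : (1 - 17 / 18)^-1 = 18 :> F by field.
have := @geom_sum_le F (17 / 18) N; rewrite e18; lra.
Qed.
End Core.
End Compositions.
End CompositionSums.

(* Locked, to keep the unary numeral from being evaluated. *)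
Definition cutoff : nat := locked (192 * 40)%N.

Lemma cutoffE : cutoff = (192 * 40)%N.
Proof. by rewrite /cutoff -lock. Qed.

Lemma leq_192_cutoff : (192 <= cutoff)%N.
Proof. by rewrite cutoffE leq_pmulr. Qed.

(** * Uniform bounds on the gain, and the sum over constrained compositions *)

Section ConstrainedSums.
Variable F : realFieldType.
Local Notation fac2 := (@fac2 F).
Local Notation fac3 := (@fac3 F).

(** If some part is at least 2, merge all others into one; the hypothesis makes the merged part at
    least 2 as well, so [fac2_merge2] applies. Otherwise the product is 1. *)
Lemma prod_fac2_le (X : finType) (a : X -> nat) (n := (\sum_x a x)%N) :
  (forall x, a x + 2 <= n)%N -> \prod_x fac2 (a x) <= fac2 (n - 2).
Proof.
move=> ha.
have merge (P : pred X) : \prod_(x | P x) fac2 (a x) <= fac2 (\sum_(x | P x) a x).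
  elim/big_rec2: _ => [|x m y _ IH]; first by rewrite fac2_0.
  by apply: le_trans (fac2_merge F _ _); rewrite ler_pM2l ?fac2_gt0.
have [/existsP[x0 hx0]|/existsPn h1] := boolP [exists x, (2 <= a x)%N].
  have hn : n = (a x0 + \sum_(x | x != x0) a x)%N by rewrite /n (bigD1 x0).
  rewrite (bigD1 x0) //=.
  apply: le_trans (_ : fac2 (a x0) * fac2 (\sum_(x | x != x0) a x) <= _).
    by rewrite ler_pM2l ?fac2_gt0.
  rewrite hn; apply: fac2_merge2 => //.
  by move: (ha x0); rewrite {1}hn leq_add2l.
rewrite big1 ?fac2_ge1 // => x _; move: (h1 x).
by case: (a x) => [|[|b]] // _; rewrite ?fac2_0 ?fac2_1.
Qed.

(** By Bernoulli 1 + c/N <= (1 + 1/N)^c, so the N-th power is at most e_N^c <= 3^c; one more factor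
    covers k = N + 1. *)
Lemma pow_bounded (c : nat) : exists2 K : F, 0 <= K &
  forall N k : nat, (0 < N)%N -> (k <= N.+1)%N -> (1 + c%:R / N%:R) ^+ k <= K.
Proof.
exists (3 ^+ c * (1 + c%:R)) => [|N k N0 kN].
  by rewrite mulr_ge0 ?exprn_ge0 // addr_ge0.
have n0 : 0 < N%:R :> F by rewrite ltr0n.
have c0 : 0 <= c%:R / N%:R :> F by rewrite divr_ge0.
apply: le_trans (_ : (1 + c%:R / N%:R) ^+ N.+1 <= _).
  by apply: ler_weXn2l => //; rewrite lerDl.
rewrite exprSr; apply: ler_pM; rewrite ?exprn_ge0 ?addr_ge0 //; last first.
  by rewrite lerD2l ler_piMr // invf_le1 // ler1n.
have hb : 1 + c%:R / N%:R <= (1 + N%:R^-1) ^+ c :> F.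
  by apply: bernoulli; apply: le_trans (_ : 0 <= _); rewrite ?invr_ge0 // oppr_le0.
apply: le_trans (_ : ((1 + N%:R^-1) ^+ c) ^+ N <= _).
  by rewrite lerXn2r // nnegrE ?exprn_ge0 ?addr_ge0 ?invr_ge0.
by rewrite exprAC -euler_seqE lerXn2r ?nnegrE ?euler_seq_le3 // ltW ?euler_seq_gt0.
Qed.

Lemma expr_sub1_le (x : F) k : 0 <= x -> (1 + x) ^+ k - 1 <= k%:R * x * (1 + x) ^+ k.
Proof.
move=> x0; elim: k => [|k IH]; first by rewrite subrr mulr_ge0 // mulr_ge0.
rewrite exprSr -natr1.
have h : 0 <= (1 + x) ^+ k by rewrite exprn_ge0 // addr_ge0.
have h2 : 0 <= x * x * (1 + x) ^+ k by rewrite !mulr_ge0.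
have h3 : 0 <= k%:R * (x * x * (1 + x) ^+ k) by rewrite mulr_ge0.
nra.
Qed.

Lemma ler_sum_inj (I J : finType) (C : {pred I}) (D : {pred J}) (h : I -> J) (v : J -> F) :
  (forall j, 0 <= v j) -> {in C &, injective h} -> {in C, forall i, h i \in D} ->
  \sum_(i in C) v (h i) <= \sum_(j in D) v j.
Proof.
move=> v0 hinj hD; rewrite -(big_imset v hinj) /=.
rewrite [leLHS]big_mkcond [leRHS]big_mkcond; apply: ler_sum => j _.
case: ifP => [/imsetP[i iC ->]|_]; last by case: ifP.
by rewrite hD.
Qed.

Lemma gain_bounded : exists2 K : F, 0 <= K & forall (X : finType) (N : nat),
  (cutoff <= N)%N -> (#|X| <= N.+1)%N -> gain X N fac3 <= K.
Proof.
have [K K0 hK] := pow_bounded 384; exists K => // X N hN hX.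
have n0 : 0 < N%:R :> F by rewrite ltr0n; apply: leq_trans hN; apply: leq_trans leq_192_cutoff.
(* The cutoff is chosen for this: with z = 192/N it gives 40 z^2 <= z, so the base is at most 1 + 2z
   = 1 + 384/N. *)
have hz : 192 / N%:R <= 1 / 40 :> F.
  rewrite ler_pdivrMr //.
  have : cutoff%:R <= N%:R :> F by rewrite ler_nat.
  rewrite cutoffE natrM; lra.
have z0 : 0 <= 192 / N%:R :> F by rewrite divr_ge0 // ltW.
rewrite /gain fac3_1; apply: le_trans (hK N #|X| _ hX); last by rewrite -(ltr0n F).
apply: le_trans (_ : (1 + 1 * (192 / N%:R) + 40 * (192 / N%:R) ^+ 2) ^+ #|X| <= _).
  by rewrite lerBlDr lerDl.
have -> : 384%:R / N%:R = 2 * (192 / N%:R) :> F by rewrite mulrA -natrM.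
rewrite lerXn2r ?nnegrE //; nra.
Qed.

(** Kills the compositions having a part 1, and with them the linear term of the gain. *)
Definition fac3_no1 (b : nat) : F := if b == 1%N then 0 else fac3 b.

(** Without its linear term the gain is O(|X| z^2) with z = 192/N, so even after multiplication by
    |X| = O(N) it stays bounded. *)
Lemma gain_no1_bounded : exists2 K : F, 0 <= K & forall (X : finType) (N : nat),
  (cutoff <= N)%N -> (#|X| <= N.+1)%N -> #|X|%:R * gain X N fac3_no1 <= K.
Proof.
have [K K0 hK] := pow_bounded 192; exists (160 * 192 ^+ 2 * K) => [|X N hN hX].
  by rewrite !mulr_ge0 ?exprn_ge0.
have n1 : (0 < N)%N by apply: leq_trans hN; apply: leq_trans leq_192_cutoff.
have n0 : 0 < N%:R :> F by rewrite ltr0n.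
set z : F := 192 / N%:R.
have hz : z <= 1 / 40.
  rewrite ler_pdivrMr //.
  have : cutoff%:R <= N%:R :> F by rewrite ler_nat.
  rewrite cutoffE natrM; lra.
have z0 : 0 <= z :> F by rewrite divr_ge0 // ltW.
rewrite /gain /fac3_no1 eqxx mul0r addr0 -/z.
set k := #|X|; set x := 40 * z ^+ 2.
have x0 : 0 <= x by rewrite mulr_ge0 ?sqr_ge0.
have xz : x <= z by rewrite /x; nra.
have h1 := expr_sub1_le k x0.
have h2 : (1 + x) ^+ k <= K.
  apply: le_trans (hK N k n1 hX); rewrite lerXn2r ?nnegrE ?addr_ge0 //.
  by rewrite lerD2l.
have hk : k%:R <= 2 * N%:R :> F by rewrite -natrM ler_nat; apply: leq_trans hX _; lia.
have k0 : 0 <= k%:R :> F by [].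
apply: le_trans (ler_wpM2l k0 h1) _.
apply: le_trans (_ : (2 * N%:R) ^+ 2 * x * K <= _); last first.
  rewrite ler_wpM2r //.
  have -> : 160 * 192 ^+ 2 = (2 * N%:R) ^+ 2 * x :> F by rewrite /x /z; field; rewrite gt_eqF.
  by [].
have -> : k%:R * (k%:R * x * (1 + x) ^+ k) = k%:R ^+ 2 * x * (1 + x) ^+ k by ring.
apply: ler_pM => //.
- by rewrite mulr_ge0 ?sqr_ge0.
- by rewrite exprn_ge0 // addr_ge0.
by rewrite ler_wpM2r // lerXn2r ?nnegrE // mulr_ge0 // ltW.
Qed.

Definition drop_at (X : finType) M (a : {ffun X -> 'I_M.+1}) (x0 : X) : {ffun X -> 'I_M.+1} :=
  [ffun x => if x == x0 then ord0 else a x].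

(* A part equal to 1 has weight 1; since the constraint determines which
   character it sits on, it can be deleted at no cost, and this saves a factor n. *)
Lemma sum_weight_constrained : exists2 K : F, 0 <= K &
  forall (X : finType) (n M : nat) (C : pred {ffun X -> 'I_M.+1}),
    (cutoff < n)%N -> (#|X| <= n)%N ->
    (forall a, C a -> total a = n) -> (forall a x, C a -> (a x < n.-1)%N) ->
    (forall a a' x x', C a -> C a' -> a x = 1%N :> nat -> a' x' = 1%N :> nat ->
       drop_at a x = drop_at a' x' -> x = x') ->
  \sum_(a | C a) weight fac3 a <= K * fac3 n.
Proof.
have [K1 K10 hK1] := gain_bounded; have [K2 K20 hK2] := gain_no1_bounded.
exists ((1 + 18 * K2) + 8 * (1 + 18 * K1)) => [|X n M C hn hX Ctot Clt Cinj].
  lra.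
have g0 a : 0 <= fac3 a by apply/ltW/fac3_gt0.
(* Split by the presence of a part 1. Without one, [fac3_no1] gives a bounded |X| * gain at once. *)
rewrite (bigID (fun a : {ffun X -> 'I_M.+1} => [exists x, a x == 1%N :> nat])) /= addrC mulrDl.
apply: lerD.
  have h0 b : 0 <= fac3_no1 b by rewrite /fac3_no1; case: ifP.
  apply: le_trans (_ : \sum_(a : {ffun X -> 'I_M.+1} | (total a == n) && [forall x, (a x < n)%N])
     weight fac3_no1 a <= _).
    rewrite [leLHS]big_mkcond [leRHS]big_mkcond; apply: ler_sum => a _.
    case: ifP => [/andP[Ca /existsPn no1]|_]; last by case: ifP => // _; exact: weight_ge0.
    rewrite (Ctot _ Ca) eqxx ifT; last first.
      by apply/forallP => x; apply: leq_trans (Clt _ x Ca) (leq_pred n).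
    rewrite le_eqVlt; apply/orP; left; apply/eqP/eq_bigr => x _.
    by rewrite /fac3_no1 (negbTE (no1 x)).
  apply: le_trans (sum_weight_nonconst _ h0 _ _ _ _) _.
  - exact: leq_trans leq_192_cutoff (ltnW hn).
  - exact: leqW.
  - by rewrite /fac3_no1 fac3_0.
  - by move=> b; rewrite /fac3_no1; case: ifP.
  rewrite mulrC ler_wpM2r // lerD2l ler_wpM2l // hK2 //; [exact: ltnW|exact: leqW].
(* With a part 1, delete it. The result is a composition of n - 1 whose parts must again be below
   the total, which is why parts are assumed below n - 1. *)
pose N := n.-1.
have nN : n = N.+1 by rewrite /N prednK //; apply: leq_trans hn.
have hN : (cutoff <= N)%N by rewrite -ltnS -nN.
pose CC (p : X * {ffun X -> 'I_M.+1}) := C p.2 && (p.2 p.1 == 1%N :> nat).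
apply: le_trans (_ : \sum_(p in CC) weight fac3 (drop_at p.2 p.1) <= _).
  apply: le_trans (@ler_sum_union _ _ X _ (fun x a => CC (x, a)) _ _ _) _.
  - exact: weight_ge0.
  - by move=> a /andP[Ca /existsP[x hx]]; exists x; rewrite /CC Ca.
  rewrite pair_big_dep /= le_eqVlt; apply/orP; left; apply/eqP.
  apply: eq_big => [[x a]|[x a] /= /andP[_ /= /eqP ha]] //.
  rewrite /weight (bigD1 x) //= [RHS](bigD1 x) //= ffunE eqxx ha fac3_1 fac3_0.
  by congr (_ * _); apply: eq_bigr => y /negPf hy; rewrite ffunE hy.
apply: le_trans (@ler_sum_inj _ _ CC
   [pred b : {ffun X -> 'I_M.+1} | (total b == N) && [forall x, (b x < N)%N]]
   (fun p => drop_at p.2 p.1) (@weight F X M fac3) _ _ _) _.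
- exact: weight_ge0.
- move=> [x a] [x' a'] /andP[/= Ca /eqP ax] /andP[/= Ca' /eqP ax'] e.
  have exx := Cinj _ _ _ _ Ca Ca' ax ax' e; subst x'.
  congr (_, _); apply/ffunP => y; have := congr1 (fun b : {ffun X -> 'I_M.+1} => b y) e.
  rewrite !ffunE; case: eqP => // -> _; apply/val_inj => /=; by rewrite ax ax'.
- move=> [x a] /andP[/= Ca /eqP ax]; rewrite inE; apply/andP; split.
    have := Ctot _ Ca; rewrite /total (bigD1 x) //= ax nN => -[ht].
    rewrite (bigD1 x) //= ffunE eqxx add0n -ht; apply/eqP/eq_bigr => y /negPf hy.
    by rewrite ffunE hy.
  apply/forallP => y; rewrite ffunE; case: ifP => _ //=; last exact: Clt.
  by apply: leq_trans hN; apply: leq_trans leq_192_cutoff.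
rewrite /=; apply: le_trans (sum_weight_nonconst _ g0 _ _ _ _) _.
- exact: leq_trans leq_192_cutoff hN.
- by rewrite -nN.
- exact: fac3_0.
- by [].
have hg : gain X N fac3 <= K1 by apply: hK1; rewrite -?nN.
(* The passage from n - 1 back to n gains a factor of order n, which pays for the |X| places of the
   largest part. *)
have hf : N.+1%:R * fac3 N <= 8 * fac3 N.+1.
  rewrite fac3S mulrCA [leLHS]mulrC ler_wpM2l // mulrCA ler_peMr //.
  rewrite ler_pdivlMr ?mul1r ?euler_seq_sqr_le8 //.
  by rewrite exprn_gt0 // euler_seq_gt0.
rewrite nN.
have hk : #|X|%:R <= N.+1%:R :> F by rewrite ler_nat -nN.
have n1 : 1 <= N.+1%:R :> F by rewrite ler1n.
move: (gain X N fac3) hg => Gn hg.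
apply: le_trans (_ : fac3 N * (N.+1%:R * (1 + 18 * K1)) <= _).
  rewrite ler_wpM2l // mulrDr mulr1 lerD // [leRHS]mulrCA ler_wpM2l //.
  apply: le_trans (_ : #|X|%:R * K1 <= _); first by rewrite ler_wpM2l.
  by rewrite ler_wpM2r.
have h18 : 0 <= 1 + 18 * K1 by lra.
have := ler_wpM2r h18 hf; lra.
Qed.
End ConstrainedSums.

(** * Permutation sums *)

Section Colourings.
Variables (X : finType) (n : nat).
Implicit Types (c : {ffun 'I_n -> X}) (s : 'S_n).

Definition fiber c x : {set 'I_n} := [set i | c i == x].
Definition ctype c : {ffun X -> 'I_n.+1} := [ffun x => inord #|fiber c x|].
Definition recolour c s : {ffun 'I_n -> X} := [ffun i => c (s i)].
Definition stab c : nat := #|[set s | recolour c s == c]|.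

Lemma ctypeE c x : ctype c x = #|fiber c x| :> nat.
Proof. by rewrite ffunE inordK // ltnS -[leqRHS]card_ord max_card. Qed.

Lemma prod_ctype (R : comPzSemiRingType) c (f : X -> R) :
  \prod_i f (c i) = \prod_x f x ^+ ctype c x.
Proof.
rewrite (partition_big c xpredT) //=; apply: eq_bigr => x _.
rewrite ctypeE -prodr_const; apply: eq_big => [i|i /eqP-> //].
by rewrite inE.
Qed.

Lemma sum_ctype c : (\sum_x ctype c x)%N = n.
Proof.
rewrite -[RHS]card_ord -sum1_card (partition_big c xpredT) //=; apply: eq_bigr => x _.
by rewrite ctypeE -sum1_card; apply: eq_bigl => i; rewrite inE.
Qed.

Lemma ctype_recolour c s : ctype (recolour c s) = ctype c.
Proof.
apply/ffunP => x; apply: val_inj; rewrite /= !ctypeE.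
rewrite -(card_preimset (fiber c x) (@perm_inj _ s)).
by apply: eq_card => i; rewrite !inE ffunE.
Qed.

Lemma ctype_transitive c c' : ctype c = ctype c' -> exists s, recolour c s = c'.
Proof.
move=> e.
have h : perm_eq (mktuple c') (mktuple c).
  apply/allP => x _ /=; apply/eqP.
  have cnt (b : {ffun 'I_n -> X}) : count_mem x (mktuple b) = ctype b x.
    rewrite ctypeE cardE -size_filter /= /mktuple /= .
    rewrite filter_map size_map /enum_mem; congr (size _).
    by rewrite -filter_predI; apply: eq_filter => i; rewrite /= !inE andbT.
  by rewrite !cnt e.
have [s /val_inj hs] := tuple_permP h; exists s; apply/ffunP => i.
have := congr1 (fun t => tnth t i) hs.
by rewrite !tnth_mktuple ffunE.
Qed.

(** The permutations taking c to c' form a coset of the stabiliser of c and also one of the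
    stabiliser of c'. *)
Lemma card_recolour c c' : ctype c = ctype c' ->
  #|[set s | recolour c s == c']| = stab c /\ #|[set s | recolour c s == c']| = stab c'.
Proof.
move=> /ctype_transitive[s0 hs0]; split.
  rewrite /stab -[RHS](card_imset _ (mulgI s0)); apply: eq_card => s.
  rewrite [LHS]inE; apply/eqP/imsetP => [hs|[t]].
    exists (s0^-1 * s)%g; last by rewrite mulKVg.
    rewrite inE; apply/eqP/ffunP => i; rewrite ffunE permM.
    have := congr1 (fun b : {ffun 'I_n -> X} => b (s0^-1 i)%g) (etrans hs (esym hs0)).
    by rewrite !ffunE permKV.
  rewrite inE => /eqP ht ->; rewrite -hs0; apply/ffunP => i.
  by rewrite !ffunE permM -[in RHS]ht ffunE.
rewrite /stab -[RHS](card_imset _ (mulIg s0)); apply: eq_card => s.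
rewrite [LHS]inE; apply/eqP/imsetP => [hs|[t]].
  exists (s * s0^-1)%g; last by rewrite mulgKV.
  rewrite inE; apply/eqP/ffunP => i.
  by rewrite -[in LHS]hs0 !ffunE permM permKV -[in RHS]hs ffunE.
rewrite inE => /eqP ht ->; rewrite -[in RHS]ht -hs0; apply/ffunP => i.
by rewrite !ffunE permM.
Qed.

Lemma sum_recolour (R : pzSemiRingType) (h : {ffun 'I_n -> X} -> R) c :
  \sum_s h (recolour c s) = (stab c)%:R * \sum_(c' | ctype c' == ctype c) h c'.
Proof.
rewrite (partition_big (recolour c) (fun c' => ctype c' == ctype c)) /= => [|s _]; last first.
  by rewrite ctype_recolour.
rewrite big_distrr /=; apply: eq_bigr => c' /eqP e.
rewrite (eq_bigr (fun=> h c')) => [|s /eqP-> //].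
rewrite -(card_recolour (esym e)).1 mulr_natl -sumr_const.
by apply: eq_bigl => s; rewrite inE.
Qed.

(** Orbit-stabiliser: the permutations split according to the colouring they produce from a fixed
    one of type a. *)
Lemma sum_stab (a : {ffun X -> 'I_n.+1}) : (\sum_(c | ctype c == a) stab c <= n`!)%N.
Proof.
have [c0 /eqP e|h] := pickP (fun c => ctype c == a); last by rewrite big_pred0.
have -> : n`! = (\sum_(s : 'S_n) 1)%N by rewrite sum1_card card_Sn.
rewrite [leqRHS](partition_big (recolour c0) (fun c => ctype c == a)) /= => [|s _]; last first.
  by rewrite ctype_recolour e.
apply: leq_sum => c /eqP ec; rewrite -(card_recolour (etrans e (esym ec))).2 -sum1_card.
by rewrite leq_eqVlt; apply/orP; left; apply/eqP/eq_bigl => s; rewrite !inE.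
Qed.

(** A stabilising permutation preserves every fiber and is determined by its restrictions to the
    fibers. *)
Lemma stab_le c : (stab c <= \prod_x (ctype c x)`!)%N.
Proof.
pose r s := [ffun x => restr_perm (fiber c x) s].
have norm s x : s \in [set s | recolour c s == c] -> s \in ('N(fiber c x | 'P))%g.
  rewrite inE => /eqP hs; apply/astabsP => i /=.
  by rewrite !inE -{2}hs ffunE.
rewrite /stab -(card_in_imset (f := r)) => [|s t hs ht /ffunP est].
  apply: leq_trans (_ : #|family (fun x => perm_on (fiber c x))| <= _)%N.
    apply/subset_leq_card/subsetP => _ /imsetP[s hs ->].
    by apply/familyP => x; rewrite ffunE; exact: restr_perm_on.
  rewrite card_family foldrE big_map big_enum /= leq_eqVlt.
  by apply/orP; left; apply/eqP/eq_bigr => x _; rewrite card_perm ctypeE.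
apply/permP => i; have := est (c i); rewrite !ffunE => e.
have hi : i \in fiber c (c i) by rewrite inE.
by rewrite -(restr_permE (norm _ _ hs) hi) -(restr_permE (norm _ _ ht) hi) e.
Qed.

End Colourings.

(** * Permanents of matrices with orthogonal columns *)

Section SymmetricSums.
Variables (X : finType) (n : nat) (m : 'I_n -> X -> algC).
Hypothesis n_gt0 : (0 < n)%N.
Hypothesis orth : forall x y, \sum_i m i x * (m i y)^* = n%:R *+ (x == y).
Implicit Types (c : {ffun 'I_n -> X}).

Definition class_sum (a : {ffun X -> 'I_n.+1}) : algC :=
  \sum_(c : {ffun 'I_n -> X} | ctype c == a) \prod_i m i (c i).

(** The permanent of the matrix with entries [m j (c i)]. *)
Definition perm_sum c : algC := \sum_(s : 'S_n) \prod_i m (s i) (c i).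

Lemma perm_sumE c : perm_sum c = (stab c)%:R * class_sum (ctype c).
Proof.
rewrite -sum_recolour /perm_sum (reindex_inj invg_inj) /=; apply: eq_bigr => s _.
rewrite (reindex_inj (@perm_inj _ s)) /=; apply: eq_bigr => i _.
by rewrite permK ffunE.
Qed.

(** AM-GM on the squared moduli of the factors, whose mean is 1 by orthogonality. *)
Lemma prod_linear_form_le (z : X -> algC) : \sum_x `|z x| ^+ 2 = 1 ->
  `|\prod_i \sum_x m i x * z x| <= 1.
Proof.
move=> hz; rewrite -(@ler_pXn2r _ 2) ?nnegrE // expr1n normr_prod -prodrXl.
apply: le_trans (leif_AGM (A := 'I_n) (E := fun i => `|\sum_x m i x * z x| ^+ 2) _).1 _.
  by move=> i _; rewrite exprn_ge0.
rewrite card_ord.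
suff -> : \sum_(i in 'I_n) `|\sum_x m i x * z x| ^+ 2 = n%:R.
  by rewrite divff ?expr1n // pnatr_eq0 -lt0n.
transitivity (\sum_x \sum_y (z x * (z y)^*) * \sum_i m i x * (m i y)^*).
  under [RHS]eq_bigr => x _ do under eq_bigr => y _ do rewrite big_distrr /=.
  under [RHS]eq_bigr => x _ do rewrite exchange_big /=.
  rewrite [RHS]exchange_big /=; apply: eq_bigr => i _.
  rewrite normCK rmorph_sum /= big_distrlr /=; apply: eq_bigr => x _.
  by apply: eq_bigr => y _; rewrite rmorphM /= mulrACA mulrC.
rewrite (_ : n%:R = n%:R * \sum_x `|z x| ^+ 2); last by rewrite hz mulr1.
rewrite big_distrr /=; apply: eq_bigr => x _.
under eq_bigr => y _ do rewrite orth.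
rewrite (bigD1 x) //= big1 ?addr0 => [|y /negPf hy].
  by rewrite eqxx normCK mulr1n mulrC.
by rewrite eq_sym hy mulr0.
Qed.

Lemma norm_prim_root k (z : algC) : k.+1.-primitive_root z -> `|z| = 1.
Proof.
move=> hz; have := congr1 Num.norm (prim_expr_order hz).
by rewrite normrX normr1 => /eqP; rewrite pexpr_eq1 // => /eqP.
Qed.

(** The order is n + 1 because the exponents 0, ..., n must stay distinct modulo it. *)
Lemma sum_root_unity (z : algC) (t a : 'I_n.+1) : n.+1.-primitive_root z ->
  \sum_(j < n.+1) (z ^+ j) ^+ t * ((z ^+ j)^*) ^+ a = n.+1%:R *+ (t == a).
Proof.
move=> hz; have z1 : `|z| = 1 := norm_prim_root hz.
have zc : z^* = z^-1 by rewrite invC_norm z1 expr1n invr1 mul1r.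
have z0 : z != 0 by rewrite -normr_eq0 z1 oner_eq0.
pose w := z ^+ t / z ^+ a.
have -> : \sum_(j < n.+1) (z ^+ j) ^+ t * ((z ^+ j)^*) ^+ a = \sum_(j < n.+1) w ^+ j.
  apply: eq_bigr => j _; rewrite rmorphXn /= zc exprMn exprAC; congr (_ * _).
  by rewrite exprAC exprVn.
have [ta|ta] := eqVneq t a.
  have -> : w = 1 by rewrite /w ta divff ?expf_neq0.
  under eq_bigr do rewrite expr1n.
  by rewrite sumr_const card_ord.
have w1 : w != 1.
  apply: contra ta => /eqP hw; have : z ^+ t = z ^+ a.
    by rewrite -[LHS](divfK (expf_neq0 a z0)) -/w hw mul1r.
  by move/eqP; rewrite (eq_prim_root_expr hz) !modn_small // => /eqP/val_inj->.
apply: (mulfI (x := w - 1)); first by rewrite subr_eq0.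
rewrite -subrX1 mulr0n mulr0 /w expr_div_n -!exprM ![(_ * n.+1)%N]mulnC !exprM.
by rewrite (prim_expr_order hz) !expr1n divr1 subrr.
Qed.

(* [class_sum a] is a coefficient of the product of the linear forms [sum_x m i x * z x];
   Fourier inversion over roots of unity extracts it at [|z x|^2 = a x / n]. *)
Lemma class_sum_bound (a : {ffun X -> 'I_n.+1}) : (\sum_x a x)%N = n ->
  `|class_sum a| ^+ 2 * \prod_x (a x)%:R ^+ a x <= n%:R ^+ n.
Proof.
move=> ha; have [z hz] := C_prim_root_exists (ltn0Sn n).
have z1 : `|z| = 1 := norm_prim_root hz.
have n0 : n%:R != 0 :> algC by rewrite pnatr_eq0 -lt0n.
pose r x : algC := sqrtC ((a x)%:R / n%:R).
have r0 x : 0 <= r x by rewrite sqrtC_ge0 divr_ge0.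
have r2 x : r x ^+ 2 = (a x)%:R / n%:R by rewrite sqrtCK.
pose f (u : {ffun X -> 'I_n.+1}) := \prod_i \sum_x m i x * (r x * z ^+ u x).
have f1 u : `|f u| <= 1.
  apply: prod_linear_form_le; under eq_bigr => x _ do
    rewrite normrM normrX z1 expr1n mulr1 ger0_norm // r2.
  by rewrite -big_distrl /= -natr_sum ha divff.
have fE u : f u = \sum_(c : {ffun 'I_n -> X}) (\prod_i m i (c i)) * \prod_x r x ^+ ctype c x
     * \prod_x (z ^+ u x) ^+ ctype c x.
  rewrite /f bigA_distr_bigA; apply: eq_bigr => c _.
  rewrite big_split /= big_split /= mulrA (prod_ctype c r).
  by rewrite (prod_ctype c (fun x => z ^+ u x)).
(* Averaging over the grid of roots of unity isolates the monomial of exponent a. *)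
have key : \sum_u f u * \prod_x ((z ^+ u x)^*) ^+ a x
    = n.+1%:R ^+ #|X| * (class_sum a * \prod_x r x ^+ a x).
  rewrite (eq_bigr _ (fun u _ => congr1 ( *%R^~ _) (fE u))) /=.
  under eq_bigr => u _ do rewrite big_distrl /=.
  rewrite exchange_big /= [RHS]mulrC -mulrA /class_sum big_distrl /= [RHS]big_mkcond /=.
  apply: eq_bigr => c _.
  under eq_bigr => u _ do rewrite -mulrA -big_split /=.
  rewrite -big_distrr /=.
  rewrite -(bigA_distr_bigA (fun x (j : 'I_n.+1) => (z ^+ j) ^+ ctype c x * ((z ^+ j)^*) ^+ a x)).
  rewrite [X in _ * X = _](eq_bigr (fun x => n.+1%:R *+ (ctype c x == a x))) => [|x _]; last first.
    exact: sum_root_unity hz.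
  have [<-|hca] := eqVneq (ctype c) a.
    rewrite [X in _ * X = _](eq_bigr (fun=> n.+1%:R)) => [|x _]; last by rewrite eqxx.
    by rewrite prodr_const mulrA.
  have [x hx] : exists x, ctype c x != a x.
    apply/existsP; rewrite -negb_forall; apply: contra hca => /forallP h.
    by apply/eqP/ffunP => x; apply/eqP.
  by rewrite [X in _ * X = _](bigD1 x) //= (negPf hx) mul0r mulr0.
have b1 : `|class_sum a * \prod_x r x ^+ a x| <= 1.
  have K0 : 0 < (n.+1%:R : algC) ^+ #|X| by rewrite exprn_gt0 // ltr0n.
  rewrite -(ler_pM2l K0) mulr1 -{1}(ger0_norm (ltW K0)) -normrM -key.
  apply: le_trans (ler_norm_sum _ _ _) _.
  apply: le_trans (_ : \sum_(u : {ffun X -> 'I_n.+1}) 1 <= _).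
    apply: ler_sum => u _; rewrite normrM [X in _ * X]normr_prod [X in _ * X]big1 ?mulr1 // => x _.
    by rewrite normrX norm_conjC normrX z1 !expr1n.
  by rewrite sumr_const card_ffun card_ord natrX.
have : `|class_sum a * \prod_x r x ^+ a x| ^+ 2 <= 1 by rewrite exprn_ile1.
have -> : `|class_sum a * \prod_x r x ^+ a x| ^+ 2
   = `|class_sum a| ^+ 2 * ((\prod_x (a x)%:R ^+ a x) / n%:R ^+ n).
  rewrite normrM exprMn; congr (_ * _).
  rewrite ger0_norm; last by apply: prodr_ge0 => x _; rewrite exprn_ge0.
  rewrite -prodrXl -[X in n%:R ^+ X]ha -prodrXr -prodf_div; apply: eq_bigr => x _.
  by rewrite exprAC r2 expr_div_n.
by rewrite mulrA ler_pdivrMr ?mul1r // exprn_gt0 // ltr0n.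
Qed.

Lemma perm_sum_sqr_le c :
  `|perm_sum c| ^+ 2 <= (stab c)%:R ^+ 2 * (n%:R ^+ n / \prod_x (ctype c x)%:R ^+ ctype c x).
Proof.
rewrite perm_sumE normrM exprMn normr_nat ler_wpM2l ?exprn_ge0 //.
rewrite ler_pdivlMr; first exact: class_sum_bound (sum_ctype c).
apply: prodr_gt0 => x _; case: (nat_of_ord _) => [|k]; first exact: ltr01.
by rewrite exprn_gt0.
Qed.

End SymmetricSums.

(** * Fourier inversion *)

(** The irreducible characters of an abelian group are linear. The last relation is second
    orthogonality against the identity, all centralisers being the whole group. *)
Lemma characters_exist (G : finZmodType) :
  exists (X : finType) (chi : X -> G -> algC),
  [/\ #|X| = #|G|, forall k x y, chi k (x + y) = chi k x * chi k y,
      forall k x, `|chi k x| = 1,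
      forall k l, \sum_x chi k x * (chi l x)^* = #|G|%:R *+ (k == l) &
      forall x, \sum_k chi k x = #|G|%:R *+ (x == 0)].
Proof.
pose GG := [set: G]%G.
have abG : abelian GG := FinRing.zmod_abelian _.
have lin (i : Iirr GG) : 'chi_i \is a linear_char by apply/char_abelianP.
have cG : #|GG| = #|G| by rewrite /= cardsT.
exists (Iirr GG), (fun i x => 'chi_i x); split.
- by rewrite card_Iirr_abelian.
- by move=> k x y; rewrite -FinRing.zmodMgE lin_charM ?inE.
- by move=> k x; rewrite normC_lin_char ?inE.
- move=> k l.
  have := first_orthogonality_relation k l; rewrite cG.
  have n0 : #|G|%:R != 0 :> algC by rewrite pnatr_eq0 -lt0n; apply/card_gt0P; exists 0.
  move/(congr1 (fun w => #|G|%:R * w)); rewrite mulVKf // mulr_natr => <-.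
  apply: eq_big => [x|x _]; first by rewrite inE.
  by rewrite lin_charV_conj ?inE.
move=> x; have := second_orthogonality_relation x (group1 GG).
rewrite class1G inE => e.
rewrite (eq_bigr (fun i : Iirr GG => 'chi_i x * ('chi_i 1%g)^*)) => [|i _]; last first.
  by rewrite lin_char1 // conjC1 mulr1.
rewrite e; congr (_%:R *+ _); rewrite -cG; congr #|pred_of_set _|.
apply/setIidPl; rewrite sub_cent1; exact: (subsetP abG).
Qed.

(** [algC] is only partially ordered, so the estimates are made over [rat] and transported. *)
Lemma fac2_ratr a : ratr (fac2 rat a) = fac2 algC a.
Proof.
by rewrite fac2.unlock fmorph_div !rmorphXn /= !ratr_nat.
Qed.
Lemma fac3_ratr a : ratr (fac3 rat a) = fac3 algC a.
Proof.
by rewrite fac3.unlock fmorph_div !rmorphXn /= !ratr_nat.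
Qed.

(** The final bound is proved in [algC] but wanted in an arbitrary real field; a statement over
    [nat] passes between the two. *)
Definition natdist (a b : nat) : nat := ((a - b) + (b - a))%N.

Lemma natdistE (R : numDomainType) a b c e :
  (`|a%:R - b%:R| * c%:R <= e%:R :> R) = (natdist a b * c <= e)%N.
Proof.
rewrite /natdist; case: (leqP a b) => h.
  by rewrite distrC -natrB // ger0_norm ?ler0n // -natrM ler_nat (eqP h) add0n.
by rewrite -natrB ?(ltnW h) // ger0_norm ?ler0n // -natrM ler_nat (eqP (ltnW h)) addn0.
Qed.

Section Fourier.
Variables (G : finZmodType) (X : finType) (chi : X -> G -> algC).
Local Notation n := #|G|.
Hypothesis card_X : #|X| = n.
Hypothesis chiD : forall k x y, chi k (x + y) = chi k x * chi k y.
Hypothesis chi_norm : forall k x, `|chi k x| = 1.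
Hypothesis chi_orth : forall k l, \sum_x chi k x * (chi l x)^* = n%:R *+ (k == l).
Hypothesis chi_sum : forall x, \sum_k chi k x = n%:R *+ (x == 0).
Implicit Types (c : {ffun 'I_n -> X}) (p : {ffun 'I_n -> G}).

Lemma card_gt0G : (0 < n)%N.
Proof. by apply/card_gt0P; exists 0. Qed.

Lemma chi_neq0 k x : chi k x != 0.
Proof. by rewrite -normr_eq0 chi_norm oner_eq0. Qed.

Lemma chi0 k : chi k 0 = 1.
Proof. by apply: (mulfI (chi_neq0 k 0)); rewrite -chiD addr0 mulr1. Qed.

Lemma chi_sumr k (I : finType) (h : I -> G) : chi k (\sum_i h i) = \prod_i chi k (h i).
Proof. by apply: (big_morph (chi k) (chiD k) (chi0 k)). Qed.

Lemma chi_mulrn k x j : chi k (x *+ j) = chi k x ^+ j.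
Proof. by elim: j => [|j IH]; rewrite ?mulr0n ?chi0 // mulrS exprS chiD IH. Qed.

Lemma chi_expn k x : chi k x ^+ n = 1.
Proof.
rewrite -chi_mulrn -(chi0 k); congr (chi k _).
have := expg_cardG (G := [set: G]%G) (in_setT x).
by rewrite /= cardsT FinRing.zmodXgE.
Qed.

Lemma chi_inj k l : chi k =1 chi l -> k = l.
Proof.
move=> e; apply/eqP; have := chi_orth k l.
rewrite (eq_bigr (fun x => chi k x * (chi k x)^*)); last by move=> x _; rewrite -e.
rewrite chi_orth eqxx; case: eqP => // _ /eqP; rewrite pnatr_eq0.
by rewrite gtn_eqF // card_gt0G.
Qed.

Definition bij_sum c : algC := \sum_(p : {ffun 'I_n -> G} | injectiveb p) \prod_i chi (c i) (p i).

Lemma bij_sumE c : bij_sum c = perm_sum (fun i x => chi x (enum_val i)) c.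
Proof.
pose h (s : 'S_n) : {ffun 'I_n -> G} := [ffun i => enum_val (s i)].
have h_inj : injective h.
  move=> s t /ffunP e; apply/permP => i; have := e i; rewrite !ffunE.
  exact: enum_val_inj.
have himg : h @: setT = [set p : {ffun 'I_n -> G} | injectiveb p].
  apply/eqP; rewrite eqEcard; apply/andP; split.
    apply/subsetP => _ /imsetP[s _ ->]; rewrite inE; apply/injectiveP => i j.
    by rewrite !ffunE => /enum_val_inj/perm_inj.
  by rewrite card_imset // cardsT card_Sn card_inj_ffuns card_ord ffactnn.
rewrite /bij_sum /perm_sum (eq_bigl (mem (h @: setT))) => [|p]; last first.
  by rewrite himg !inE.
rewrite big_imset /=; last by move=> s t _ _; exact: h_inj.
apply: eq_big => [s|s _]; first by rewrite inE.
apply: eq_bigr => i _.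
by rewrite ffunE.
Qed.

Lemma enum_orth x y :
  \sum_(i < n) chi x (enum_val i) * (chi y (enum_val i))^* = n%:R *+ (x == y).
Proof.
rewrite -(chi_orth x y) [RHS](reindex_onto enum_val enum_rank) => [|z _]; last exact: enum_rankK.
by apply: eq_bigl => i; rewrite /= enum_valK eqxx.
Qed.

Lemma fac_den_ge0 (a : {ffun X -> 'I_n.+1}) : 0 <= \prod_x (a x)%:R ^+ a x :> algC.
Proof. by apply: prodr_ge0 => x _; rewrite exprn_ge0. Qed.

Lemma bij_sum_sqr_le c :
  `|bij_sum c| ^+ 2 <= n%:R ^+ n * \prod_x fac2 algC (ctype c x).
Proof.
rewrite bij_sumE; apply: le_trans (perm_sum_sqr_le card_gt0G enum_orth c) _.
have -> : \prod_x fac2 algC (ctype c x)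
  = (\prod_x (ctype c x)`!)%:R ^+ 2 / \prod_x (ctype c x)%:R ^+ ctype c x.
  by rewrite natr_prod -prodrXl -prodf_div; apply: eq_bigr => x _; rewrite fac2.unlock.
rewrite mulrCA ler_wpM2l ?exprn_ge0 // ler_wpM2r ?invr_ge0 ?fac_den_ge0 //.
by rewrite lerXn2r ?nnegrE // ler_nat stab_le.
Qed.

(** Only three of the four factors [stab c] are bounded by the product of factorials; the fourth is
    kept, since over a class these sum to at most n!. *)
Lemma bij_sum_exp4_le c :
  `|bij_sum c| ^+ 4 <= (stab c)%:R * ((n%:R ^+ n) ^+ 2 * \prod_x fac3 algC (ctype c x)).
Proof.
rewrite bij_sumE; have h := perm_sum_sqr_le card_gt0G enum_orth c.
rewrite (exprM _ 2 2); apply: le_trans (lerXn2r 2 _ _ h) _.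
- by rewrite nnegrE exprn_ge0.
- by rewrite nnegrE mulr_ge0 ?exprn_ge0 // divr_ge0 ?exprn_ge0 ?fac_den_ge0.
set D := \prod_x _%:R ^+ _; set A := (\prod_x (ctype c x)`!)%N.
have -> : \prod_x fac3 algC (ctype c x) = A%:R ^+ 3 / D ^+ 2.
  rewrite /A /D natr_prod -!prodrXl -prodf_div; apply: eq_bigr => x _.
  by rewrite fac3.unlock.
have -> : ((stab c)%:R ^+ 2 * (n%:R ^+ n / D)) ^+ 2
   = (stab c)%:R * ((n%:R ^+ n) ^+ 2 * ((stab c)%:R ^+ 3 / D ^+ 2)).
  rewrite !exprMn exprVn; ring.
rewrite !(ler_wpM2l, ler_wpM2r) ?invr_ge0 ?exprn_ge0 ?fac_den_ge0 //.
by rewrite lerXn2r ?nnegrE // ler_nat stab_le.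
Qed.

Definition balanced (a : {ffun X -> 'I_n.+1}) :=
  [forall g, \prod_x chi x g ^+ a x == 1].

(** Translating all bijections by g permutes them and multiplies the sum by the product of the
    c_i(g), which must therefore be 1. *)
Lemma bij_sum_balanced c : bij_sum c != 0 -> balanced (ctype c).
Proof.
move=> c0; apply/forallP => g; apply/eqP; rewrite -(prod_ctype c (fun x => chi x g)).
pose h (v : G) p : {ffun 'I_n -> G} := [ffun i => p i + v].
have hK : cancel (h g) (h (- g)) by move=> p; apply/ffunP => i; rewrite !ffunE addrK.
have hK' : cancel (h (- g)) (h g) by move=> p; apply/ffunP => i; rewrite !ffunE subrK.
apply: (mulIf c0); rewrite mul1r [RHS]/bij_sum (reindex (h g)) /=; last first.
  by exists (h (- g)) => p _; [exact: hK | exact: hK'].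
rewrite /bij_sum big_distrr /=; apply: eq_big => [p|p _].
  apply/injectiveP/injectiveP => inj i j.
    by rewrite !ffunE => /addIr/inj.
  by move=> e; apply: inj; rewrite !ffunE e.
by rewrite -big_split; apply: eq_bigr => i _; rewrite ffunE chiD mulrC.
Qed.

Definition nonconst c := [forall x, c != [ffun=> x]].

(** If all c_i but one equal x, balancedness and x^n = 1 force the last one to be x too. *)
Lemma nonconst_lt c x : balanced (ctype c) -> nonconst c -> (ctype c x < n.-1)%N.
Proof.
move=> /forallP bal /forallP nc; rewrite ltnNge; apply/negP => hx.
rewrite ctypeE in hx.
have n1 := card_gt0G.
have hC : (#|~: fiber c x| <= 1)%N.
  rewrite -(leq_add2l #|fiber c x|) cardsC card_ord addn1.
  by apply: leq_trans (leqSpred _) _; rewrite ltnS.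
have {hC} [h0|h1] : #|~: fiber c x| = 0%N \/ #|~: fiber c x| = 1%N.
- by move: hC; case: #|_| => [|[|]] //; [left | right].
- have := nc x; apply/negP; rewrite negbK; apply/eqP/ffunP => i; rewrite ffunE.
  have /setP/(_ i) := cards0_eq h0; rewrite !inE.
  by move/negbFE/eqP.
have /cards1P[i0 hi0] : #|~: fiber c x| == 1%N by rewrite h1.
have ci i : (c i != x) = (i == i0) by have /setP/(_ i) := hi0; rewrite !inE.
suff e : c i0 = x by have := ci i0; rewrite e !eqxx.
apply: chi_inj => g.
have := eqP (bal g); rewrite -(prod_ctype c (fun y => chi y g)) (bigD1 i0) //=.
rewrite (eq_bigr (fun=> chi x g)) => [|i]; last by rewrite -ci negbK => /eqP->.
rewrite prodr_const cardC1 card_ord => e.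
apply: (mulIf (expf_neq0 n.-1 (chi_neq0 x g))).
by rewrite e -exprS prednK // chi_expn.
Qed.

(** All parts are at most n - 2, so the square is at most n^n [fac2 (n - 2)] <= 18 n!^2/n^2, and 18
    <= 5^2. *)
Lemma bij_sum_le c : (2 <= n)%N -> nonconst c -> `|bij_sum c| <= 5 * (n`!)%:R / n%:R.
Proof.
move=> n2 nc; have n0 : 0 < n%:R :> algC by rewrite ltr0n card_gt0G.
have [->|c0] := eqVneq (bij_sum c) 0; first by rewrite normr0 divr_ge0 ?mulr_ge0.
rewrite -(@ler_pXn2r _ 2) ?nnegrE ?divr_ge0 ?mulr_ge0 //.
apply: le_trans (bij_sum_sqr_le c) _.
have bal := bij_sum_balanced c0.
have h1 : \prod_x fac2 rat (ctype c x) <= fac2 rat (n - 2).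
  have := @prod_fac2_le rat X (fun x => ctype c x); rewrite sum_ctype; apply=> x.
  have := nonconst_lt x bal nc; lia.
have h2 := fac2_sub2 rat n2.
have h3 : n%:R ^+ 2 * \prod_x fac2 rat (ctype c x) <= 18 * fac2 rat n.
  by apply: le_trans h2; rewrite ler_wpM2l // exprn_ge0.
have h4 : n%:R ^+ 2 * (n%:R ^+ n * \prod_x fac2 rat (ctype c x)) <= 18 * (n`!)%:R ^+ 2.
  rewrite mulrCA; apply: le_trans (ler_wpM2l _ h3) _; first by rewrite exprn_ge0.
  rewrite fac2E le_eqVlt; apply/orP; left; apply/eqP.
  have d0 : n%:R ^+ n != 0 :> rat by rewrite gt_eqF // pow_self_gt0.
  by move: (_ ^+ n) d0 => w w0; field.
have : ratr (n%:R ^+ 2 * (n%:R ^+ n * \prod_x fac2 rat (ctype c x)))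
    <= ratr (18 * (n`!)%:R ^+ 2) :> algC.
  by rewrite ler_rat.
rewrite !rmorphM !rmorphXn /= !ratr_nat rmorph_prod /=.
under eq_bigr do rewrite fac2_ratr.
move=> h5; rewrite expr_div_n ler_pdivlMr ?exprn_gt0 // mulrC; apply: le_trans h5 _.
rewrite exprMn; apply: ler_wpM2r; first exact: mulr_ge0.
by rewrite -natrX ler_nat.
Qed.

Lemma bij_sum_const x : bij_sum [ffun=> x] = (n`!)%:R * chi x (\sum_g g).
Proof.
rewrite /bij_sum (eq_bigr (fun=> chi x (\sum_g g))) => [|p /injectiveP p_inj].
  rewrite sumr_const mulr_natl; congr (_ *+ _).
  transitivity #|[set p : {ffun 'I_n -> G} | injectiveb p]|; first by rewrite cardsE.
  by rewrite card_inj_ffuns card_ord ffactnn.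
rewrite [in RHS](reindex p) /=; last first.
  by apply: onW_bij; apply: inj_card_bij => //; rewrite card_ord.
by rewrite chi_sumr; apply: eq_bigr => i _; rewrite ffunE.
Qed.

(** The product over i of the character sums at (p_1 + ... + p_d - f)(i) is n^n on solutions and 0
    elsewhere; expanding it, the sum over tuples factors into d equal sums. *)
Lemma num_solutions_fourier d (f : {ffun 'I_n -> G}) :
  n%:R ^+ n * (num_solutions d f)%:R
   = \sum_(c : {ffun 'I_n -> X}) (\prod_i chi (c i) (- f i)) * bij_sum c ^+ d.
Proof.
pose inj (p : {ffun 'I_n -> G}) := injectiveb p.
transitivity (\sum_(p : {ffun 'I_d -> {ffun 'I_n -> G}} | p \in ffun_on inj)
   \prod_(i < n) \sum_x chi x ((\sum_k p k) i - f i)).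
  rewrite /num_solutions -sum1_card natr_sum big_distrr /= big_mkcond [RHS]big_mkcond /=.
  apply: eq_bigr => p _; rewrite inE.
  have -> : (p \in ffun_on inj) = [forall k, injectiveb (p k)].
    by apply/ffun_onP/forallP => h k; have := h k.
  case: ifP => [/andP[-> /eqP <-]|].
    rewrite mulr1 (eq_bigr (fun=> n%:R)) => [|i _]; last by rewrite subrr chi_sum eqxx.
    by rewrite prodr_const card_ord.
  case: ifP => // _ /= /negbT hf.
  have [i hi] : exists i, (\sum_k p k) i != f i.
    apply/existsP; rewrite -negb_forall; apply: contra hf => /forallP h.
    by apply/eqP/ffunP => i; apply/eqP.
  by rewrite (bigD1 i) //= chi_sum subr_eq0 (negPf hi) mul0r.
under eq_bigr => p _ do rewrite bigA_distr_bigA /=.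
rewrite exchange_big /=; apply: eq_bigr => c _.
rewrite /bij_sum -[X in _ ^+ X]card_ord -prodr_const bigA_distr_big big_distrr /=.
apply: eq_bigr => p _.
rewrite exchange_big -big_split /=; apply: eq_bigr => i _.
by rewrite addrC chiD sum_ffunE chi_sumr.
Qed.

(** Group colourings by type: a type contributes at most n! n^(2n) times its weight, and n! n^(2n)
    [fac3 n] = n!^4. *)
Lemma sum_bij_sum_exp4 (K : rat) :
  \sum_(a : {ffun X -> 'I_n.+1} | [&& balanced a, total a == n & [forall x, (a x < n.-1)%N]])
     weight (fac3 rat) a <= K * fac3 rat n ->
  \sum_(c | nonconst c) `|bij_sum c| ^+ 4 <= ratr K * (n`!)%:R ^+ 4.
Proof.
move=> hK.
pose C (a : {ffun X -> 'I_n.+1}) :=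
  [&& balanced a, total a == n & [forall x, (a x < n.-1)%N]].
have g0 (a : {ffun X -> 'I_n.+1}) : 0 <= \prod_x fac3 algC (a x).
  by apply: prodr_ge0 => x _; rewrite -fac3_ratr ler0q ltW // fac3_gt0.
apply: le_trans (_ : \sum_(a | C a) (n`!)%:R * ((n%:R ^+ n) ^+ 2 * \prod_x fac3 algC (a x)) <= _).
  apply: le_trans (_ : \sum_(a | C a) \sum_(c | ctype c == a) `|bij_sum c| ^+ 4 <= _).
    rewrite [leLHS]big_mkcond; under [leRHS]eq_bigr do rewrite big_mkcond.
    rewrite exchange_big /=; apply: ler_sum => c _.
    have s0 : 0 <= \sum_(a | C a) (if ctype c == a then `|bij_sum c| ^+ 4 else 0).
      by apply: sumr_ge0 => a _; case: ifP => // _; rewrite exprn_ge0.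
    case: ifP => // nc; have [e0|c0] := eqVneq (bij_sum c) 0.
      by rewrite e0 normr0 expr0n in s0 *.
    have bal := bij_sum_balanced c0.
    have Cc : C (ctype c).
      rewrite /C bal /total sum_ctype eqxx; apply/forallP => x; exact: nonconst_lt.
    rewrite (bigD1 (ctype c)) //= eqxx lerDl; apply: sumr_ge0 => a _.
    by case: ifP => // _; rewrite exprn_ge0.
  apply: ler_sum => a _.
  apply: le_trans (_ : \sum_(c | ctype c == a)
    (stab c)%:R * ((n%:R ^+ n) ^+ 2 * \prod_x fac3 algC (a x)) <= _).
    by apply: ler_sum => c /eqP <-; exact: bij_sum_exp4_le.
  rewrite -big_distrl /= ler_wpM2r ?mulr_ge0 ?exprn_ge0 //.
  by rewrite -natr_sum ler_nat sum_stab.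
rewrite -big_distrr -big_distrr /=.
have -> : \sum_(a | C a) \prod_x fac3 algC (a x) = ratr (\sum_(a | C a) weight (fac3 rat) a).
  rewrite rmorph_sum; apply: eq_bigr => a _; rewrite /weight rmorph_prod /=; apply: eq_bigr => x _.
  by rewrite fac3_ratr.
apply: le_trans (_ : (n`!)%:R * ((n%:R ^+ n) ^+ 2 * ratr (K * fac3 rat n)) <= _).
  by rewrite !ler_wpM2l ?exprn_ge0 // ler_rat.
rewrite rmorphM /= fac3_ratr fac3.unlock le_eqVlt; apply/orP; left; apply/eqP.
have d0 : n%:R ^+ n != 0 :> algC by rewrite expf_neq0 // pnatr_eq0 -lt0n card_gt0G.
by move: (_ ^+ n) d0 => w w0; field.
Qed.

Lemma num_solutions_error d (f : {ffun 'I_n -> G}) (K : rat) :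
  (4 <= d)%N -> (2 <= n)%N -> \sum_i f i = (\sum_x x) *+ d ->
  \sum_(c | nonconst c) `|bij_sum c| ^+ 4 <= ratr K * (n`!)%:R ^+ 4 ->
  `|n%:R ^+ n.-1 * (num_solutions d f)%:R - (n`!)%:R ^+ d| * n%:R ^+ (d - 3)
    <= ratr K * 5 ^+ (d - 4) * (n`!)%:R ^+ d :> algC.
Proof.
move=> d4 n2 hf hK; have n1 := card_gt0G.
have n0 : 0 < n%:R :> algC by rewrite ltr0n.
have F0 : 0 < (n`!)%:R :> algC by rewrite ltr0n fact_gt0.
pose err := \sum_(c | nonconst c) (\prod_i chi (c i) (- f i)) * bij_sum c ^+ d.
have main : n%:R * (n%:R ^+ n.-1 * (num_solutions d f)%:R - (n`!)%:R ^+ d) = err.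
  rewrite mulrBr mulrA -exprS prednK // num_solutions_fourier (bigID nonconst) /=.
  suff -> : \sum_(c | ~~ nonconst c) (\prod_i chi (c i) (- f i)) * bij_sum c ^+ d
     = n%:R * (n`!)%:R ^+ d by rewrite addrK.
  rewrite (eq_bigl (mem ((fun x : X => [ffun=> x] : {ffun 'I_n -> X}) @: setT)))
    => [|c]; last first.
    apply/forallPn/imsetP => [[x]|[x _ ->]]; last by exists x; rewrite eqxx.
    by rewrite negbK => /eqP ->; exists x.
  rewrite big_imset /=; last first.
    by move=> x y _ _ /ffunP/(_ (Ordinal n1)); rewrite !ffunE.
  rewrite (eq_bigr (fun=> (n`!)%:R ^+ d)) => [|x _].
    by rewrite sumr_const cardsT card_X mulr_natl.
  (* The hypothesis on f makes the phase cancel the d-th power of chi x at the sum of G. *)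
  rewrite bij_sum_const exprMn mulrCA.
  rewrite (eq_bigr (fun i => chi x (- f i))) => [|i _]; last by rewrite ffunE.
  by rewrite -chi_sumr sumrN hf -chi_mulrn -chiD addNr chi0 mulr1.
(* Four factors go into the fourth moment; the other d - 4 are bounded pointwise by 5 n!/n. *)
have e4 (w : algC) : w ^+ d = w ^+ (d - 4) * w ^+ 4 by rewrite -exprD subnK.
have errb : `|err| * n%:R ^+ (d - 4) <= ratr K * 5 ^+ (d - 4) * (n`!)%:R ^+ d.
  apply: le_trans (_ : (\sum_(c | nonconst c) (5 * (n`!)%:R / n%:R) ^+ (d - 4) * `|bij_sum c| ^+ 4)
      * n%:R ^+ (d - 4) <= _).
    rewrite ler_wpM2r ?exprn_ge0 //; apply: le_trans (ler_norm_sum _ _ _) _.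
    apply: ler_sum => c nc; rewrite normrM normr_prod big1 => [|i _]; last exact: chi_norm.
    rewrite mul1r normrX e4 ler_wpM2r ?exprn_ge0 //.
    by rewrite lerXn2r ?nnegrE ?bij_sum_le // divr_ge0 // mulr_ge0.
  rewrite -big_distrr /= mulrAC -exprMn divfK ?gt_eqF // exprMn.
  have -> : ratr K * 5 ^+ (d - 4) * (n`!)%:R ^+ d
     = 5 ^+ (d - 4) * (n`!)%:R ^+ (d - 4) * (ratr K * (n`!)%:R ^+ 4) :> algC.
    by rewrite (e4 (n`!)%:R); ring.
  by rewrite ler_wpM2l // mulr_ge0 ?exprn_ge0.
have e : `|err| = n%:R * `|n%:R ^+ n.-1 * (num_solutions d f)%:R - (n`!)%:R ^+ d|.
  by rewrite -main normrM normr_nat.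
(* The n constant colourings put a factor n in front of the main term; dividing by it supplies the
   last power of n. *)
rewrite (_ : (d - 3 = (d - 4).+1)%N); last by lia.
by rewrite exprS mulrCA mulrA -e.
Qed.

End Fourier.

(** * Groups above and below the cutoff, and the conclusion *)

Lemma num_solutions_large d : (4 <= d)%N -> exists C : nat,
  forall (G : finZmodType) (f : {ffun 'I_#|G| -> G}), (cutoff < #|G|)%N ->
    \sum_i f i = (\sum_x x) *+ d ->
  (natdist (#|G| ^ #|G|.-1 * num_solutions d f) (#|G|`! ^ d) * #|G| ^ (d - 3)
     <= C * #|G|`! ^ d)%N.
Proof.
move=> d4; have [K K0 hK] := sum_weight_constrained rat.
pose K' : algC := ratr K * 5 ^+ (d - 4).
have K'0 : 0 <= K' by rewrite mulr_ge0 ?exprn_ge0 // ler0q.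
have [C hC] : exists C : nat, K' <= C%:R.
  by exists (Num.bound K'); apply/ltW/archi_boundP.
exists C => G f hn hf; rewrite -(natdistE algC).
have [X [chi [cX chiD chiN chiO chiS]]] := characters_exist G.
have n2 : (2 <= #|G|)%N by apply: leq_trans hn; rewrite ltnS; apply: leq_trans leq_192_cutoff.
rewrite !natrM !natrX; apply: le_trans (num_solutions_error cX chiD chiN chiO chiS d4 n2 hf _) _.
  apply: sum_bij_sum_exp4 => //; apply: hK => //; first by rewrite cX.
  - by move=> a /and3P[_ /eqP].
  - by move=> a x /and3P[_ _ /forallP].
  move=> a a' x x' /and3P[/forallP b _ _] /and3P[/forallP b' _ _] ax ax' e.
  apply: (chi_inj chiO) => g.
  (* The value at g of the character carrying the deleted 1 is the inverse of the product over the
     remaining parts, so equal remainders give equal characters. *)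
  have E (a1 : {ffun X -> 'I_#|G|.+1}) y : a1 y = 1%N :> nat -> \prod_z chi z g ^+ a1 z == 1 ->
      chi y g * \prod_z chi z g ^+ drop_at a1 y z = 1.
    move=> ay /eqP e1; rewrite -[RHS]e1 [in RHS](bigD1 y) //= ay expr1; congr (_ * _).
    rewrite (bigD1 y) //= /drop_at ffunE eqxx expr0 mul1r; apply: eq_bigr => z /negPf hz.
    by rewrite ffunE hz.
  have E1 := E _ _ ax (b g); have E2 := E _ _ ax' (b' g); rewrite -e in E2.
  have B0 : \prod_z chi z g ^+ drop_at a x z != 0.
    by apply/eqP => B0; move: E1; rewrite B0 mulr0 => /eqP; rewrite eq_sym oner_eq0.
  by apply: (mulIf B0); rewrite E1 E2.
by rewrite ler_wpM2r ?exprn_ge0.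
Qed.

(** For bounded order every quantity is bounded in terms of d, and n!^d >= 1 lets one constant
    absorb them. *)
Lemma num_solutions_small d : exists C : nat,
  forall (G : finZmodType) (f : {ffun 'I_#|G| -> G}), (#|G| <= cutoff)%N ->
  (natdist (#|G| ^ #|G|.-1 * num_solutions d f) (#|G|`! ^ d) * #|G| ^ (d - 3)
     <= C * #|G|`! ^ d)%N.
Proof.
pose T := cutoff; have T0 : (0 < T)%N by apply: leq_trans leq_192_cutoff.
exists ((T ^ T * (T ^ T) ^ d + 1) * T ^ (d - 3))%N => G f hn.
have F0 : (0 < #|G|`! ^ d)%N by rewrite expn_gt0 fact_gt0.
have mono (a b k : nat) : (a <= b)%N -> (a ^ k <= b ^ k)%N.
  by case: k => // k ab; rewrite leq_exp2r.
have hX k : (k <= T)%N -> (#|G| ^ k <= T ^ T)%N.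
  by move=> hk; apply: leq_trans (mono _ _ _ hn) _; rewrite leq_pexp2l.
have hN : (num_solutions d f <= (T ^ T) ^ d)%N.
  apply: leq_trans (max_card _) _; rewrite !card_ffun !card_ord.
  exact/mono/hX.
have hA : (#|G| ^ #|G|.-1 * num_solutions d f <= T ^ T * (T ^ T) ^ d)%N.
  by apply: leq_mul => //; apply: hX; apply: leq_trans (leq_pred _) hn.
rewrite /natdist; move: (#|G| ^ _ * _)%N (_ * (T ^ T) ^ d)%N hA => A B hA.
rewrite mulnAC; apply: leq_mul; last exact: mono.
apply: leq_trans (_ : A + #|G|`! ^ d <= _)%N; first by apply: leq_add; exact: leq_subr.
by rewrite mulnDl mul1n leq_add2r (leq_trans hA) // leq_pmulr.
Qed.

Theorem theorem1p4 (R : realFieldType) (d : nat) :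
  (4 <= d)%N ->
  exists C : R, forall (G : finZmodType) (f : {ffun 'I_#|G| -> G}),
    \sum_(i < #|G|) f i = (\sum_(x : G) x) *+ d ->
    let n := #|G| in
    `| (num_solutions d f)%:R / ((n`!)%:R ^+ d / (n%:R ^+ n.-1)) - 1 | <= C / n%:R ^+ (d - 3).
Proof.
move=> d4; have [C1 hC1] := num_solutions_large d4; have [C2 hC2] := num_solutions_small d.
exists (C1 + C2)%:R => G f hf /=; set n := #|G|.
have n0 : 0 < n%:R :> R by rewrite ltr0n card_gt0G.
have F0 : 0 < (n`!)%:R ^+ d :> R by rewrite exprn_gt0 // ltr0n fact_gt0.
have h : `|n%:R ^+ n.-1 * (num_solutions d f)%:R - (n`!)%:R ^+ d| * n%:R ^+ (d - 3)
    <= (C1 + C2)%:R * (n`!)%:R ^+ d :> R.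
  rewrite -!natrX -!natrM natdistE.
  have [hn|hn] := leqP n cutoff.
    by apply: leq_trans (hC2 G f hn) _; rewrite leq_mul2r leq_addl orbT.
  by apply: leq_trans (hC1 G f hn hf) _; rewrite leq_mul2r leq_addr orbT.
rewrite ler_pdivlMr ?exprn_gt0 // -(ler_pM2r F0); apply: le_trans h.
rewrite mulrAC ler_wpM2r ?exprn_ge0 ?(ltW n0) // -[X in _ * X](ger0_norm (ltW F0)) -normrM.
rewrite mulrBl mul1r invf_div le_eqVlt; apply/orP; left; apply/eqP; congr `|_ - _|.
by rewrite mulrA divfK ?gt_eqF // mulrC.
Qed.
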